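(* Let $\Gamma$ be a non-elementary hyperbolic group equipped with a finite symmetric set of generators $S$. Let $\mathbf{S}_n:=\{x\in\Gamma:|x|_S=n\}$ for integers $n\ge0$. If $d\in\mathcal{D}_\Gamma$, then for every open set $U$ and every closed set $V$ in $\mathbb{R}$ such that $U\subset V$, we have $$-\inf_{s\in U}I(s)\le\liminf_{n\to\infty}\frac1n\log\left(\frac{1}{\#\mathbf{S}_n}\#\left\{x\in\mathbf{S}_n:\frac{d(o,x)}{n}\in U\right\}\right)$$ $$\le\limsup_{n\to\infty}\frac1n\log\left(\frac{1}{\#\mathbf{S}_n}\#\left\{x\in\mathbf{S}_n:\frac{d(o,x)}{n}\in V\right\}\right)\le-\inf_{s\in V}I(s),$$ where $$I(s)=\theta_{d/d_S}(0)+\sup_{t\in\mathbb{R}}\{ts-\theta_{d/d_S}(-t)\}$$ and $\theta_{d/d_S}$ is the Manhattan curve for the pair of metrics $d$ and $d_S$. Furthermore, $I$ has a unique zero at the mean distortion $\tau(d/d_S)$, is finite on $(\alpha_{\min},\alpha_{\max})$ and infinite outside of $[\alpha_{\min},\alpha_{\max}]$, where $$\alpha_{\min}=-\lim_{a\to\infty}\frac{\theta_{d/d_S}(a)}{a}\quad\text{and}\quad\alpha_{\max}=-\lim_{a\to-\infty}\frac{\theta_{d/d_S}(a)}{a}.$$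
   Context: A metric $d$ on a set $X$ is hyperbolic if there is $\delta\ge 0$ such that $(x|y)_w\ge \min\{(x|z)_w,(z|y)_w\}-\delta$ for all $x,y,z,w\in X$, where $(x|y)_w=\frac12\big(d(w,x)+d(w,y)-d(x,y)\big)$. For a finite symmetric generating set $S$ of $\Gamma$ (identity $o$), $|x|_S$ is word length and $d_S(x,y)=|x^{-1}y|_S$ the word metric. $\Gamma$ is hyperbolic if some word metric is hyperbolic; it is non-elementary if it is moreover non-amenable (equivalently, neither finite nor virtually $\mathbb{Z}$). Two metrics $d,d'$ are quasi-isometric if there are $L>0,C\ge0$ with $L^{-1}d(x,y)-C\le d'(x,y)\le L\,d(x,y)+C$ for all $x,y$. $\mathcal{D}_\Gamma$ is the set of left-invariant hyperbolic metrics on $\Gamma$ that are quasi-isometric to some (equivalently, every) word metric. $\theta_{d/d_S}(a)$ is, for each $a\in\mathbb{R}$, the abscissa of convergence in $b$ of $\sum_{x\in\Gamma}\exp(-a\,d(o,x)-b\,|x|_S)$; equivalently $\theta_{d/d_S}(a)=\lim_{n\to\infty}\frac1n\log\sum_{|x|_S=n}e^{-a\,d(o,x)}$. The mean distortion is $\tau(d/d_S)=\lim_{r\to\infty}\frac{1}{\#B_S(o,r)}\sum_{x\in B_S(o,r)}\frac{d(o,x)}{r}$, where $B_S(o,r)=\{x\in\Gamma:|x|_S\le r\}$. *)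

(* Defs.v *)
From HB Require Import structures.
From mathcomp Require Import all_boot all_order all_algebra finmap.
From mathcomp Require Import all_classical all_reals all_analysis.
Set Implicit Arguments.
Unset Strict Implicit.
Unset Printing Implicit Defensive.
Import Order.TTheory GRing.Theory Num.Theory.
Import numFieldNormedType.Exports.
Local Open Scope classical_set_scope.
Local Open Scope ring_scope.

Definition is_metric {R : realType} {X : Type} (d : X -> X -> R) : Prop :=
  [/\ forall x y, 0 <= d x y,
      forall x y, d x y = 0 <-> x = y,
      forall x y, d x y = d y x &
      forall x y z, d x z <= d x y + d y z].

Definition gromov_product {R : realType} {X : Type} (d : X -> X -> R)
  (w x y : X) : R := 2^-1 * (d w x + d w y - d x y).

Definition hyperbolic {R : realType} {X : Type} (d : X -> X -> R) : Prop :=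
  exists2 delta : R, 0 <= delta &
    forall x y z w, gromov_product d w x y >=
      Num.min (gromov_product d w x z) (gromov_product d w z y) - delta.

Definition quasi_isometric {R : realType} {X : Type} (d d' : X -> X -> R) :
    Prop :=
  exists L C : R, [/\ 0 < L, 0 <= C &
    forall x y, L^-1 * d x y - C <= d' x y /\ d' x y <= L * d x y + C].

Definition left_invariant {R : realType} {G : groupType} (d : G -> G -> R) :
    Prop :=
  forall g x y : G, d (g * x)%g (g * y)%g = d x y.

Definition is_word {G : groupType} (S : set G) (n : nat) (x : G) : Prop :=
  exists w : seq G,
    [/\ size w = n, forall g, g \in w -> S g & x = (\prod_(g <- w) g)%g].

Definition finite_symmetric_generators {G : groupType} (S : set G) : Prop :=
  [/\ finite_set S,
      forall g, S g -> S (g^-1)%g &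
      forall x, exists n, is_word S n x].

(* The default value 0 is only taken at points not generated by S. *)
Definition word_length {G : groupType} (S : set G) (x : G) : nat :=
  xget 0%N [set n | is_word S n x /\ forall m, is_word S m x -> (n <= m)%N].

Definition word_metric (R : realType) {G : groupType} (S : set G) (x y : G) :
  R := (word_length S (x^-1 * y)%g)%:R.

Definition hyperbolic_group (R : realType) (G : groupType) : Prop :=
  exists2 S : set G, finite_symmetric_generators S &
    hyperbolic (word_metric R S).

Definition amenable (R : realType) (G : groupType) : Prop :=
  exists mu : set G -> R,
    [/\ forall A, 0 <= mu A,
        mu setT = 1,
        forall A B, A `&` B = set0 -> mu (A `|` B) = mu A + mu B &
        forall (g : G) A, mu [set (g * x)%g | x in A] = mu A].

Definition non_elementary_hyperbolic (R : realType) (G : groupType) : Prop :=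
  hyperbolic_group R G /\ ~ amenable R G.

Definition D_metric {R : realType} {G : groupType} (d : G -> G -> R) : Prop :=
  [/\ is_metric d, left_invariant d, hyperbolic d &
      exists2 S : set G, finite_symmetric_generators S &
        quasi_isometric d (word_metric R S)].

Definition sphere {G : groupType} (S : set G) (n : nat) : set G :=
  [set x | word_length S x = n].

Definition word_ball {R : realType} {G : groupType} (S : set G) (r : R) :
  set G := [set x | (word_length S x)%:R <= r].

(* Meaningful only for finite A: fset_set A is empty when A is infinite. *)
Definition card_set (R : realType) {T : choiceType} (A : set T) : R :=
  (#|` fset_set A|)%:R.

(* theta_{d/d_S}(a), as an abscissa of convergence in b; it is valued in the
   extended reals, so that the infimum needs no side condition. *)
Definition manhattan {R : realType} {G : groupType} (d : G -> G -> R)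
    (S : set G) (a : R) : \bar R :=
  ereal_inf [set b%:E | b in [set b : R |
    (\esum_(x in [set: G])
       (expR (- a * d 1%g x - b * (word_length S x)%:R))%:E < +oo)%E]].

Definition rate {R : realType} {G : groupType} (d : G -> G -> R)
    (S : set G) (s : R) : \bar R :=
  (manhattan d S 0 +
   ereal_sup (range (fun t : R => (t * s)%:E - manhattan d S (- t))))%E.

Definition average_distortion {R : realType} {G : groupType}
    (d : G -> G -> R) (S : set G) (r : R) : R :=
  (card_set R (word_ball S r))^-1 *
    \sum_(x \in word_ball S r) (d 1%g x / r).

(* (1/n) log of the proportion of x in the n-sphere with d(o, x) / n in A,
   with log 0 = -oo. *)
Definition log_proportion {R : realType} {G : groupType} (d : G -> G -> R)
    (S : set G) (A : set R) (n : nat) : \bar R :=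
  ((n%:R^-1)%:E *
   lne ((card_set R (sphere S n))^-1 *
        card_set R [set x | sphere S n x /\ A (d 1%g x / n%:R)])%:E)%E.

(* Main.v *)
(* Write D x = d(1, x). S-geodesics are quasi-geodesics for d, so a Morse lemma for
   the four-point condition (no geodesics of d are available) shows that D is
   additive up to a constant along them: the sphere of radius n + m splits into the
   product of the spheres of radii n and m. Conversely, non-amenability makes balls
   grow exponentially, and a count of shadows produces, for any x and y, a bounded
   element z such that x z y is almost a geodesic concatenation, in S and in d.
   Hence the tilted sums Z_n(t) = sum of exp(t D x) over |x| = n are multiplicative
   up to constants, so that log Z_n(t) = n Lam(t) + O(1) with Lam convex and
   theta(a) = Lam(-a).

   The key point is that Lam is differentiable. A corner with slopes s1 < s2 would
   leave a definite proportion of the tilted mass of every large sphere near each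
   of n s1 and n s2; concatenating spheres of complementary radii then leaves a
   definite proportion near each of arbitrarily many disjoint windows between
   them. Differentiability gives concentration of the tilted measures, whence the
   lower bound by tilting; the upper bound is Chernoff's inequality. *)
Require Import Defs.
From HB Require Import structures.
From mathcomp Require Import all_boot all_order all_algebra.
From mathcomp Require Import all_classical all_reals all_analysis.
From mathcomp Require Import finmap zify ring lra.
Import Order.TTheory GRing.Theory Num.Theory.
Import numFieldNormedType.Exports.
Local Open Scope classical_set_scope.
Local Open Scope ring_scope.
Set Implicit Arguments.
Unset Strict Implicit.
Unset Printing Implicit Defensive.

(** * Quasi-geodesics for a four-point hyperbolic metric *)

(** The Morse lemma rests on an extremal argument. Let M be the largest Gromov product along the
    path. The four-point condition, iterated dyadically, costs [delta] times the logarithm of a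
    number of points, and only stretches of length linear in M are involved; this yields M <= A + B
    log M, hence a bound that does not depend on the path. Concatenation of spheres is not
    injective: the connecting element varies, and the product has to be cut back to the exact radius
    n + m. A code in a fixed finite list records what is lost, so that multiplicities only cost a
    constant factor. In the corner argument the order of choices is the obstacle: the proportion of
    mass near each end slope determines the number of disjoint windows needed, and that number
    determines their width. The proportion must therefore be fixed before the width. *)

Lemma linear_le_exp2 (R : realType) (a b : R) :
  exists p0 : nat, forall p : nat, (p0 <= p)%N -> a + b * p%:R <= (2 ^ p)%:R.
Proof.
pose K := (Num.truncn (Num.max a b)).+1.
have hK : Num.max a b < K%:R by exact: truncnS_gt.
have {hK} [aK bK] : a <= K%:R /\ b <= K%:R.
  by move: hK; rewrite gt_max => /andP[/ltW ? /ltW ?].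
exists (4 * K)%N => p hp.
have h2 n : (n.+1 <= 2 ^ n)%N by exact: ltn_expl.
have hq : (2 * K * p./2.+1 <= 2 ^ p)%N.
  apply: (@leq_trans (2 ^ p./2 * 2 ^ p./2)).
    by apply: leq_mul => //; apply: leq_trans (h2 _); lia.
  by rewrite -expnD leq_exp2l //; lia.
apply: (@le_trans _ _ (K%:R + K%:R * p%:R)).
  by apply: lerD => //; apply: ler_wpM2r.
rewrite -natrM -natrD ler_nat; apply: leq_trans hq.
by rewrite -mulnS -mulnA mulnCA leq_pmul2l //; lia.
Qed.

Ltac natlia :=
  repeat match goal with
  | H : context [@Order.le] |- _ => clear H
  | H : context [@Order.lt] |- _ => clear H
  end; lia.

Section Morse.
Variables (R : realType) (X : Type) (d : X -> X -> R) (delta : R).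
Hypothesis dm : is_metric d.
Hypothesis delta_ge0 : 0 <= delta.
Hypothesis hyp : forall x y z w, gromov_product d w x y >=
  Num.min (gromov_product d w x z) (gromov_product d w z y) - delta.

Local Notation gp := (gromov_product d).

Let d_ge0 x y : 0 <= d x y. Proof. by case: dm. Qed.
Let dxx x : d x x = 0. Proof. by case: dm => _ h _ _; apply/h. Qed.
Let dC x y : d x y = d y x. Proof. by case: dm. Qed.
Let dtri x y z : d x z <= d x y + d y z. Proof. by case: dm. Qed.

Lemma gromov_product_min w x z y m :
  m <= gp w x z -> m <= gp w z y -> m - delta <= gp w x y.
Proof.
move=> h1 h2; apply: le_trans (hyp x y z w).
by rewrite lerD2r le_min h1.
Qed.

Lemma gromov_productC w x y : gp w x y = gp w y x.
Proof. by rewrite /gromov_product (dC x y); lra. Qed.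

Lemma gromov_product_ge0 w x y : 0 <= gp w x y.
Proof. by rewrite /gromov_product; move: (dtri x w y) (dC x w); lra. Qed.

Lemma gromov_product_le w x y : gp w x y <= d w x.
Proof. by rewrite /gromov_product; move: (dtri w x y); lra. Qed.

Lemma gromov_product_xx w x : gp w x x = d w x.
Proof. by rewrite /gromov_product dxx; lra. Qed.

Lemma gromov_product_base w x y : gp w x y = d w x - gp x w y.
Proof. by rewrite /gromov_product (dC w x); lra. Qed.

Lemma gromov_product_dist w x y : d x y = d w x + d w y - 2 * gp w x y.
Proof. by rewrite /gromov_product; lra. Qed.

Lemma gromov_product_step w x y : d w x - d x y <= gp w x y.
Proof. by rewrite /gromov_product; move: (dtri w y x) (dC x y); lra. Qed.

(** Halving the chain spends one [delta] per level, so the loss is logarithmic in the number of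
    points instead of linear. *)
Lemma gromov_product_chain (p N : nat) (x : nat -> X) (w : X) (m : R) :
  (0 < N)%N -> (N <= 2 ^ p)%N ->
  (forall l, (l < N)%N -> m <= gp w (x l) (x l.+1)) ->
  m - p%:R * delta <= gp w (x 0%N) (x N).
Proof.
elim: p N x => [|p IH] N x N0 Np hx.
  have -> : N = 1%N by move: Np; rewrite expn0; natlia.
  by rewrite mul0r subr0; apply: hx.
have pd : p.+1%:R * delta = p%:R * delta + delta by rewrite -natr1; lra.
have [Np'|pN] := leqP N (2 ^ p).
  by have := IH _ _ N0 Np' hx; move: delta_ge0; lra.
have h1 := IH (2 ^ p)%N x (expn_gt0 _ _) (leqnn _)
  (fun l hl => hx l (ltn_trans hl pN)).
have h2 : m - p%:R * delta <= gp w (x (2 ^ p)%N) (x N).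
  have := IH (N - 2 ^ p)%N (fun i => x (2 ^ p + i)%N).
  rewrite addn0 subnKC ?(ltnW pN) //; apply; first by natlia.
    by move: Np; rewrite expnS; natlia.
  by move=> l hl; rewrite addnS; apply: hx; natlia.
by have := gromov_product_min h1 h2; lra.
Qed.

Variables (L C : R).
Hypothesis L_ge1 : 1 <= L.
Hypothesis C_ge0 : 0 <= C.

(* The path comes back from [z 0] to its base point [w]: before its Gromov
   product with [z 0] drops below [H], it has to pass close to [w]. *)
Lemma near_point_on_path (p N : nat) (z : nat -> X) (H : R) :
  (N <= 2 ^ p)%N -> 0 <= H -> H <= d (z N) (z 0%N) ->
  (forall l, (l < N)%N -> d (z l) (z l.+1) <= L) ->
  exists2 l, (l <= N)%N &
    d (z N) (z l) <= H + 2 * L + p%:R * delta /\ H <= gp (z N) (z 0%N) (z l).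
Proof.
set w := z N => Np H0 Hd hs.
pose P i := gp w (z 0%N) (z i) <= H.
have exP : exists i, P i.
  by exists N; rewrite /P gromov_productC (le_trans (gromov_product_le _ _ _)) // dxx.
pose i := ex_minn exP.
have [Pi imin iE] : [/\ P i, forall j, P j -> (i <= j)%N & True].
  by rewrite /i; case: ex_minnP.
have iN : (i <= N)%N.
  apply: imin; rewrite /P gromov_productC.
  by rewrite (le_trans (gromov_product_le _ _ _)) // dxx.
have pd : 0 <= p%:R * delta by exact: mulr_ge0.
have [i0|i0] := posnP i.
  exists 0%N => //; move: Pi; rewrite i0 /P gromov_product_xx => Pi.
  by split => //; move: L_ge1; lra.
have /existsNP[l /not_implyP[li /negP]] : ~ forall l, (l < i)%N ->
    H + L + p%:R * delta <= gp w (z l) (z l.+1).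
  move=> h; have := gromov_product_chain i0 (leq_trans iN Np) h.
  by move: Pi L_ge1; rewrite /P; lra.
rewrite -ltNge => hl; exists l; first by natlia.
have lN : (l < N)%N by exact: leq_trans iN.
split; first by have := gromov_product_step w (z l) (z l.+1); have := hs _ lN; lra.
rewrite leNgt; apply/negP => /ltW /imin; natlia.
Qed.

(** Cutting the path after its last visit to the ball of radius 2M + L around [y 0] leaves at most
    2^p steps, whatever N is. Since the next point is outside that ball, the bound M on the products
    makes the cut point agree with [y N] up to height M, seen from [y 0]. *)
Lemma near_point_on_ray (p N : nat) (y : nat -> X) (M : R) :
  0 <= M -> L * (2 * M + L) + C <= (2 ^ p)%:R ->
  (forall s, (s < N)%N -> d (y s) (y s.+1) <= L) ->
  (forall s, (s <= N)%N -> s%:R <= L * d (y 0%N) (y s) + C) ->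
  (forall s, (s <= N)%N -> gp (y s) (y 0%N) (y N) <= M) ->
  M <= d (y 0%N) (y N) ->
  exists2 l, (l <= N)%N &
    d (y 0%N) (y l) <= M + 2 * L + p%:R * delta /\
    M - delta <= gp (y 0%N) (y l) (y N).
Proof.
set w := y 0%N => M0 Mp hs hq hM Md.
pose P s := (s <= N)%N && (d w (y s) <= 2 * M + L).
have P0 : P 0%N by rewrite /P /= dxx; move: L_ge1; lra.
have exP : exists s, P s by exists 0%N.
have bP s : P s -> (s <= N)%N by case/andP.
pose n := ex_maxn exP bP.
have [/andP[nN dn] nmax] : P n /\ forall s, P s -> (s <= n)%N.
  by rewrite /n; case: ex_maxnP.
have gpn : M <= gp w (y n) (y N).
  move: nN; rewrite leq_eqVlt => /orP[/eqP nE|nN].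
    by rewrite nE gromov_product_xx.
  have : ~~ P n.+1 by apply/negP => /nmax; rewrite ltnn.
  rewrite /P nN /= -ltNge => dn1.
  rewrite gromov_product_base.
  have := hM _ (ltnW nN); have := hs _ nN; have := dtri w (y n) (y n.+1); lra.
have np : (n <= 2 ^ p)%N.
  rewrite -(ler_nat R); apply: le_trans Mp; apply: le_trans (hq _ nN) _.
  by rewrite lerD2r; apply: ler_wpM2l => //; move: L_ge1; lra.
have Mdn : M <= d w (y n) by apply: le_trans gpn (gromov_product_le _ _ _).
have := @near_point_on_path p n (fun t => y (n - t)%N) M np M0.
rewrite subnn subn0 => /(_ Mdn); case.
  move=> l ln; rewrite dC; have -> : (n - l = (n - l.+1).+1)%N by natlia.
  by apply: hs; natlia.
move=> l ln [h1 h2]; exists (n - l)%N; first by natlia.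
split=> //; apply: gromov_product_min gpn.
by rewrite gromov_productC.
Qed.

Definition quasigeodesic (x : nat -> X) (n : nat) :=
  forall i j, (i <= j)%N -> (j <= n)%N ->
    d (x i) (x j) <= L * (j - i)%:R /\ (j - i)%:R <= L * d (x i) (x j) + C.

(** Points [a] and [b] of the path, one on each side of [x k] and at distance about M from it,
    inherit the product M of the two ends, so their distance is O(L + p delta). The quasi-geodesic
    inequality then bounds the number of steps between them, and M is at most L times that number,
    up to [delta]. *)
Lemma quasigeodesic_max_triple (x : nat -> X) (n p i k j : nat) (M : R) :
  quasigeodesic x n -> (i <= k)%N -> (k <= j)%N -> (j <= n)%N ->
  gp (x k) (x i) (x j) = M ->
  (forall a b c, (a <= b)%N -> (b <= c)%N -> (c <= n)%N ->
     gp (x b) (x a) (x c) <= M) ->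
  L * (2 * M + L) + C <= (2 ^ p)%:R ->
  M <= delta + 4 * L ^+ 3 + 6 * L ^+ 2 * delta + L * C +
       2 * L ^+ 2 * delta * p%:R.
Proof.
move=> qx ik kj jn MT Mmax Mp.
have M0 : 0 <= M by rewrite -MT gromov_product_ge0.
have step s : (s < n)%N -> d (x s) (x s.+1) <= L.
  by move=> sn; have [+ _] := qx s s.+1 (leqnSn _) sn; rewrite subSn // subnn mulr1.
have [||||l lN [l1 l2]] :=
    @near_point_on_ray p (k - i) (fun s => x (k - s)%N) M M0 Mp.
- move=> s sk; rewrite dC; have -> : (k - s = (k - s.+1).+1)%N by natlia.
  by apply: step; natlia.
- move=> s sk; rewrite subn0 dC.
  by have [] := qx (k - s)%N k; rewrite ?leq_subr ?subKn //; natlia.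
- move=> s sk; rewrite subn0 gromov_productC; apply: Mmax; natlia.
- by rewrite subn0 subKn // -MT gromov_product_le.
move: l1 l2; rewrite subn0 subKn // => l1 l2.
have [||||r rN [r1 r2]] :=
    @near_point_on_ray p (j - k) (fun s => x (k + s)%N) M M0 Mp.
- by move=> s sk; rewrite addnS; apply: step; natlia.
- move=> s sk; rewrite addn0.
  by have [||_] := qx k (k + s)%N; rewrite ?addKn //; natlia.
- by move=> s sk; rewrite addn0; apply: Mmax; natlia.
- by rewrite addn0 subnKC // -MT gromov_productC gromov_product_le.
move: r1 r2; rewrite addn0 subnKC // => r1 r2.
set a := x (k - l)%N in l1 l2; set b := x (k + r)%N in r1 r2.
have ab : M - 3 * delta <= gp (x k) a b.
  have h : M - 2 * delta <= gp (x k) a (x j).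
    have := @gromov_product_min (x k) a (x i) (x j) (M - delta).
    by rewrite MT; move=> /(_ l2); move: delta_ge0; lra.
  have := @gromov_product_min (x k) a (x j) b (M - 2 * delta).
  by rewrite (gromov_productC _ (x j)); move=> /(_ h); move: delta_ge0; lra.
have dab := gromov_product_dist (x k) a b.
have [||_ h] := qx (k - l)%N (k + r)%N; [natlia|natlia|].
have [||h' _] := qx (k - l)%N k; [natlia|natlia|].
move: h; rewrite -/a -/b => h; move: h'; rewrite -/a (_ : (k - (k - l))%N = l); last natlia.
rewrite dC => h'.
have lr : l%:R <= (k + r - (k - l))%:R :> R by rewrite ler_nat; natlia.
have dl : M - delta <= d (x k) a by apply: le_trans l2 (gromov_product_le _ _ _).
have h3 : d a b <= 4 * L + 2 * p%:R * delta + 6 * delta by lra.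
have L0 : 0 <= L by move: L_ge1; lra.
have h4 : L * d a b <= L * (4 * L + 2 * p%:R * delta + 6 * delta).
  exact: ler_wpM2l.
have h5 : L * l%:R <= L * (L * (4 * L + 2 * p%:R * delta + 6 * delta) + C).
  by apply: ler_wpM2l => //; lra.
have -> : delta + 4 * L ^+ 3 + 6 * L ^+ 2 * delta + L * C +
   2 * L ^+ 2 * delta * p%:R =
   delta + L * (L * (4 * L + 2 * p%:R * delta + 6 * delta) + C) by ring.
lra.
Qed.

Lemma quasigeodesic_stable : exists2 M0 : R, 0 <= M0 &
  forall x n, quasigeodesic x n -> forall i k j,
    (i <= k)%N -> (k <= j)%N -> (j <= n)%N -> gp (x k) (x i) (x j) <= M0.
Proof.
pose A := delta + 4 * L ^+ 3 + 6 * L ^+ 2 * delta + L * C.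
pose B := 2 * L ^+ 2 * delta.
have L0 : 0 <= L by move: L_ge1; lra.
have A0 : 0 <= A by rewrite /A !addr_ge0 ?mulr_ge0 ?exprn_ge0.
have B0 : 0 <= B by rewrite /B !mulr_ge0 ?exprn_ge0.
(* If the least admissible exponent were [p.+1] with p > p0, then M <= A + B (p + 1) would already
   make p admissible. The summand A + B in place of A accounts for this shift by one. *)
have [p0 hp0] := linear_le_exp2 (L * (2 * (A + B) + L) + C) (L * (2 * B)).
exists (A + B * (p0.+1)%:R); first by rewrite addr_ge0 // mulr_ge0.
move=> x n qx.
pose T := ('I_n.+1 * 'I_n.+1 * 'I_n.+1)%type.
pose P (t : T) := (t.1.1 <= t.1.2 <= t.2)%N.
pose F (t : T) := gp (x t.1.2) (x t.1.1) (x t.2).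
have P0 : P (ord0, ord0, ord0) by [].
case: (@arg_maxP _ _ _ _ P F P0) => -[[i k] j] /andP[/= ik kj] hmax.
pose M := F (i, k, j).
have Mmax a b c : (a <= b)%N -> (b <= c)%N -> (c <= n)%N ->
     gp (x b) (x a) (x c) <= M.
  move=> ab bc cn.
  have an : (a < n.+1)%N by natlia.
  have bn : (b < n.+1)%N by natlia.
  have := hmax (Ordinal an, Ordinal bn, Ordinal (cn : (c < n.+1)%N)).
  by apply; rewrite /P /= ab.
suff MA : M <= A + B * p0.+1%:R.
  by move=> a b c ab bc cn; apply: le_trans (Mmax _ _ _ ab bc cn) _.
have key p : L * (2 * M + L) + C <= (2 ^ p)%:R -> M <= A + B * p%:R.
  by move=> hp; apply: (@quasigeodesic_max_triple x n p i k j M) => //; rewrite -ltnS.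
have exp : exists p, L * (2 * M + L) + C <= (2 ^ p)%:R.
  have [p hp] := linear_le_exp2 (L * (2 * M + L) + C) 0.
  by exists p; have := hp p (leqnn _); rewrite mul0r addr0.
case: (ex_minnP exp) => p hp pmin.
have [pp|pp] := leqP p p0.+1.
  apply: le_trans (key _ hp) _; rewrite lerD2l; apply: ler_wpM2l => //.
  by rewrite ler_nat.
case: p pp hp pmin => // p pp hp pmin.
have := hp0 p (ltnW pp : (p0 <= p)%N).
have Mle := key _ hp.
have : (2 ^ p)%:R < L * (2 * M + L) + C.
  by rewrite ltNge; apply/negP => /pmin; rewrite ltnn.
have : L * (2 * M) <= L * (2 * (A + B * p.+1%:R)) by apply: ler_wpM2l => //; lra.
rewrite -!natr1 => *; nra.
Qed.

(** Take the first point of the path at least as far from [x 0] as q. Seen from [x 0], it and q both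
    point towards [x n] and have nearly the same height, so they are close. If no point is that far,
    the endpoint serves. *)
Lemma quasigeodesic_project : exists2 B : R, 0 <= B &
  forall x n, quasigeodesic x n -> forall q A,
    gp q (x 0%N) (x n) <= A -> exists2 k, (k <= n)%N & d q (x k) <= B + 2 * A.
Proof.
have [M0 M0_ge0 hM] := quasigeodesic_stable.
exists (L + 2 * (M0 + delta)).
  by move: L_ge1 delta_ge0; lra.
move=> x n qx q A hA.
have A0 : 0 <= A by apply: le_trans (gromov_product_ge0 _ _ _) hA.
set o := x 0%N.
have hq : d o q - A <= gp o q (x n) by rewrite gromov_product_base; lra.
pose P k := (k <= n)%N && (d o q <= d o (x k)).
have [exP|hn] := pselect (exists k, P k); last first.
  exists n => //.
  have dn : d o (x n) <= d o q.
    by rewrite leNgt; apply/negP => /ltW h; apply: hn; exists n; rewrite /P leqnn.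
  by rewrite (gromov_product_dist o); move: L_ge1 delta_ge0; lra.
case: (ex_minnP exP) => k /andP[kn hk] kmin.
exists k => //.
have dk : d o (x k) <= d o q + L.
  case: k kn kmin {hk} => [|k] kn kmin.
    by rewrite dxx; move: (d_ge0 o q) L_ge1; lra.
  have h : d o (x k) <= d o q.
    rewrite leNgt; apply/negP => /ltW h.
    by have := kmin k; rewrite /P h (ltnW kn) => /(_ isT); rewrite ltnn.
  have [+ _] := qx k k.+1 (leqnSn _) kn; rewrite subSn // subnn mulr1.
  by have := dtri o (x k) (x k.+1); lra.
have h2 : d o q - M0 <= gp o (x n) (x k).
  rewrite gromov_productC gromov_product_base.
  by have := hM _ _ qx 0%N k n (leq0n _) kn (leqnn _); rewrite -/o; lra.
have h3 : d o q - M0 - A - delta <= gp o q (x k).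
  by apply: (@gromov_product_min o q (x n)); lra.
by rewrite (gromov_product_dist o); lra.
Qed.

End Morse.

(** * Word length and growth of non-amenable groups *)

Section WordLength.
Variables (G : groupType) (S : set G).
Hypothesis hS : finite_symmetric_generators S.

Local Notation len := (word_length S).

Lemma word_lengthP x :
  is_word S (len x) x /\ forall m, is_word S m x -> (len x <= m)%N.
Proof.
have [_ _ /(_ x)[n hn]] := hS.
have /cid[m hm] : exists n, is_word S n x /\ forall m, is_word S m x -> (n <= m)%N.
  have ex : exists n, `[< is_word S n x >] by exists n; apply/asboolP.
  case: (ex_minnP ex) => m /asboolP mw mmin; exists m; split => // k /asboolP.
  exact: mmin.
exact: (@xgetI _ 0%N [set n | is_word S n x /\ forall m, is_word S m x -> (n <= m)%N] _ hm).
Qed.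

Lemma is_wordM n m x y : is_word S n x -> is_word S m y -> is_word S (n + m) (x * y)%g.
Proof.
move=> [v [<- hv ->]] [w [<- hw ->]]; exists (v ++ w); split.
- by rewrite size_cat.
- by move=> g; rewrite mem_cat => /orP[/hv|/hw].
- by rewrite big_cat.
Qed.

Lemma word_length_le n x : is_word S n x -> (len x <= n)%N.
Proof. by have [_] := word_lengthP x; apply. Qed.

Lemma word_lengthM x y : (len (x * y)%g <= len x + len y)%N.
Proof.
apply: word_length_le; apply: is_wordM; first by have [] := word_lengthP x.
by have [] := word_lengthP y.
Qed.

Lemma word_length_gen g : S g -> (len g <= 1)%N.
Proof.
move=> Sg; apply: word_length_le; exists [:: g]; split => //.
  by move=> h; rewrite inE => /eqP ->.
by rewrite big_seq1.
Qed.

Lemma word_lengthV x : len (x^-1)%g = len x.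
Proof.
have le y : (len (y^-1)%g <= len y)%N.
  have [[w [ws hw wy]] _] := word_lengthP y.
  apply: word_length_le; exists (rev [seq g^-1%g | g <- w]); split.
  - by rewrite size_rev size_map.
  - move=> g; rewrite mem_rev => /mapP[h /hw Sh ->].
    by have [_ hV _] := hS; apply: hV.
  - by rewrite {1}wy -map_rev big_map prodgV revK.
by apply/eqP; rewrite eqn_leq le -{1}(invgK x) le.
Qed.

Lemma word_length1 : len 1%g = 0%N.
Proof.
apply/eqP; rewrite -leqn0; apply: word_length_le; exists [::]; split => //.
by rewrite big_nil.
Qed.

Lemma word_length_eq0 x : len x = 0%N -> x = 1%g.
Proof.
move=> h; have [+ _] := word_lengthP x; rewrite h => -[w [/size0nil -> _ ->]].
by rewrite big_nil.
Qed.

(** Prefixes of a shortest word: the pieces of the path are no longer than their numbers of letters,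
    and these add up to [len x], so no piece can be shorter. *)
Lemma geodesic_exists x : exists p : nat -> G,
  [/\ p 0%N = 1%g, p (len x) = x & forall i j, (i <= j)%N -> (j <= len x)%N ->
    len ((p i)^-1 * p j)%g = (j - i)%N].
Proof.
have [[w [ws hw wx]] _] := word_lengthP x.
pose p k := (\prod_(g <- take k w) g)%g.
have pE i j : (i <= j)%N -> ((p i)^-1 * p j = \prod_(g <- drop i (take j w)) g)%g.
  move=> ij; rewrite /p -{1}(cat_take_drop i (take j w)) take_takel //.
  by rewrite big_cat mulKg.
have ple i j : (i <= j)%N -> (j <= len x)%N -> (len ((p i)^-1 * p j)%g <= j - i)%N.
  move=> ij jx; apply: word_length_le; exists (drop i (take j w)); split.
  - by rewrite size_drop size_take ws; case: ltnP => //; lia.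
  - by move=> g /mem_drop /mem_take /hw.
  - exact: pE.
have p0 : p 0%N = 1%g by rewrite /p take0 big_nil.
have px : p (len x) = x by rewrite /p -ws take_size -wx.
exists p; split => // i j ij jx.
have h1 := ple i j ij jx.
have h0 := ple 0%N i (leq0n _) (leq_trans ij jx).
have h2 := ple j (len x) jx (leqnn _).
have : (len x <= len ((p 0)^-1 * p i)%g + len ((p i)^-1 * p j)%g
                 + len ((p j)^-1 * p (len x))%g)%N.
  have {1}-> : x = ((p 0)^-1 * p i * ((p i)^-1 * p j) * ((p j)^-1 * p (len x)))%g.
    by rewrite px p0 invg1 mul1g mulVKg mulVKg.
  by apply: leq_trans (word_lengthM _ _) _; rewrite leq_add2r word_lengthM.
by lia.
Qed.

Lemma finite_word_ball n : finite_set [set x | (len x <= n)%N].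
Proof.
have [fS _ _] := hS.
elim: n => [|n IH].
  apply: (@sub_finite_set _ _ [set 1%g]); last exact: finite_set1.
  by move=> x /=; rewrite leqn0 => /eqP/word_length_eq0.
apply: (@sub_finite_set _ _ ([set x | (len x <= n)%N] `|`
   [set (x * y)%g | x in [set x | (len x <= n)%N] & y in S])).
  move=> x /= xn; have [h|h] := leqP (len x) n; [by left|right].
  have {h xn} xE : len x = n.+1 by lia.
  have [[w [ws hw wx]] _] := word_lengthP x.
  move: ws; rewrite xE; case/lastP: w hw wx => // w g hw -> /eqP.
  rewrite size_rcons eqSS => /eqP ws.
  exists (\prod_(h <- w) h)%g.
    rewrite /= -ws; apply: word_length_le; exists w; split => // h hh; apply: hw.
    by rewrite mem_rcons inE hh orbT.
  exists g; first by apply: hw; rewrite mem_rcons inE eqxx.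
  by rewrite -cats1 big_cat big_seq1.
by rewrite finite_setU; split => //; exact: finite_image2.
Qed.

Definition wball n : {fset G} := fset_set [set x | (len x <= n)%N].
Definition wsphere n : {fset G} := fset_set (sphere S n).

Lemma finite_sphere n : finite_set (sphere S n).
Proof.
apply: sub_finite_set (finite_word_ball n) => x /= ->; exact: leqnn.
Qed.

Lemma in_wball n x : (x \in wball n) = (len x <= n)%N.
Proof.
rewrite /wball in_fset_set; last exact: finite_word_ball.
by apply/idP/idP => [/set_mem|h] //; exact: mem_set.
Qed.

Lemma in_wsphere n x : (x \in wsphere n) = (len x == n).
Proof.
rewrite /wsphere in_fset_set; last exact: finite_sphere.
by apply/idP/eqP => [/set_mem|h] //; exact: mem_set.
Qed.

Lemma card_wball_gt0 n : (0 < #|` wball n|)%N.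
Proof.
by rewrite cardfs_gt0; apply/fset0Pn; exists 1%g; rewrite in_wball word_length1.
Qed.

Lemma wball_subset m n : (m <= n)%N -> (wball m `<=` wball n)%fset.
Proof. by move=> mn; apply/fsubsetP => x; rewrite !in_wball => /leq_trans; apply. Qed.

End WordLength.

(** * Exponential growth of balls from non-amenability *)

Lemma ultrafilter_cvg_segment (R : realType) (U : set_system nat) (f : nat -> R) (a b : R) :
  UltraFilter U -> (forall k, a <= f k <= b) -> exists l : R, f @ U --> l.
Proof.
move=> hU fab.
have fU : UltraFilter (f @ U).
  split; first exact: fmap_proper_filter.
  move=> V VF UV; apply/seteqP; split => // B VB.
  have [//|VC] := in_ultra_setVsetC (f @^-1` B) hU.
  by have [x []] := filter_ex (filterI VB (UV (~` B) VC)).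
have /= : compact `[a, b]%classic by exact: segment_compact.
rewrite compact_ultra => /(_ _ fU)[|l [_ /= hl]]; last by exists l.
by apply: (@filterE _ U _ (f @^-1` `[a, b]%classic)) => k /=; rewrite in_itv; exact: fab.
Qed.

Section Growth.
Variables (R : realType) (G : groupType) (S : set G).
Hypothesis hS : finite_symmetric_generators S.
Local Notation len := (word_length S).
Local Notation ball := (wball S).

Let count (A : set G) n : R := #|` [fset x in ball n | x \in A]%fset|%:R.

(** The preimage of a ball under translation by s lies in the next ball, so only points of the
    boundary layer can add to the count. *)
Lemma count_translate (A : set G) s n : S s ->
  count [set (s * x)%g | x in A] n <=
  count A n + (#|` ball n.+1|%:R - #|` ball n|%:R).
Proof.
move=> Ss.
have sub : (ball n `<=` ball n.+1)%fset by exact: wball_subset.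
rewrite /count -natrB ?fsubset_leq_card // -natrD ler_nat -cardfsDS //.
pose A' := [fset x in ball n | x \in A]%fset.
apply: (@leq_trans #|` (fun x => (s * x)%g) @` (A' `|` (ball n.+1 `\` ball n))|%fset).
  apply: fsubset_leq_card; apply/fsubsetP => y; rewrite !inE /=.
  move=> /andP[yn /set_mem[x Ax sxy]].
  apply/imfsetP; exists x => //=; rewrite !inE /= (mem_set Ax) andbT.
  case: (boolP (x \in ball n)) => //= _.
  move: yn; rewrite !(in_wball hS) => yn.
  have -> : x = (s^-1 * y)%g by rewrite -sxy mulKg.
  rewrite (leq_trans (word_lengthM hS _ _)) // (word_lengthV hS).
  by have := word_length_gen hS Ss; lia.
apply: leq_trans (leq_imfset_card _ _ _) _; exact: leq_card_fsetU.
Qed.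

(** If the ratios of successive balls came arbitrarily close to 1, such balls would form a Foelner
    sequence, and an ultrafilter limit of the densities in them would be an invariant mean. *)
Lemma nonamenable_growth : ~ amenable R G -> exists2 eps : R, 0 < eps &
  forall n, (1 + eps) * #|` ball n|%:R <= #|` ball n.+1|%:R.
Proof.
move=> namen; apply: contrapT => hno; apply: namen.
have b0 n : 0 < #|` ball n|%:R :> R by rewrite ltr0n (card_wball_gt0 hS).
have /choice[n hn] : forall k : nat, exists n,
    #|` ball n.+1|%:R < (1 + k.+1%:R^-1) * #|` ball n|%:R :> R.
  move=> k; apply: contrapT => h; apply: hno.
  exists (k.+1%:R^-1); first by rewrite invr_gt0.
  by move=> n; rewrite leNgt; apply/negP => h'; apply: h; exists n.
pose mu A k := count A (n k) / #|` ball (n k)|%:R.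
have [U [hU ooU]] := ultraFilterLemma (@eventually_filter).
have mu01 A k : 0 <= mu A k <= 1.
  rewrite /mu divr_ge0 ?ler0n //= ler_pdivrMr // mul1r ler_nat.
  by apply: fsubset_leq_card; apply/fsubsetP => x; rewrite !inE => /andP[].
have /choice[nu hnu] : forall A, exists l : R, mu A @ U --> l.
  by move=> A; exact: ultrafilter_cvg_segment (mu01 A).
have inv1 : (fun k : nat => k.+1%:R^-1 : R) @ U --> 0.
  by move=> B /(@cvg_harmonic R) /ooU.
have le_nu A B (e : nat -> R) : e @ U --> 0 -> (forall k, mu A k <= mu B k + e k) ->
    nu A <= nu B.
  move=> e0 h; have cB : (fun k => mu B k + e k) @ U --> nu B + 0 by exact: cvgD.
  rewrite -[nu B]addr0; apply: (ler_cvg_to (hnu A) cB); exact: nearW.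
(* The boundary layer has relative size at most 1 / (k + 1), which vanishes in the limit. Only an
   inequality comes out; applying it to the inverse element gives equality. *)
have gen_le s A : S s -> nu [set (s * x)%g | x in A] <= nu A.
  move=> Ss; apply: le_nu inv1 _ => k.
  rewrite /mu ler_pdivrMr // mulrDl divfK ?gt_eqF //.
  apply: le_trans (count_translate A (n k) Ss) _; rewrite lerD2l.
  by rewrite lerBlDl; move/ltW: (hn k); rewrite mulrDl mul1r.
have gen_le' g A : nu [set (g * x)%g | x in A] <= nu A.
  have [_ _ /(_ g)[m [w [_ + ->]]]] := hS.
  elim: w A {g} => [|g w IH] A hw.
    rewrite big_nil; have -> // : [set (1 * x)%g | x in A] = A.
    by apply/seteqP; split => [y [x Ax <-]|x Ax]; rewrite ?mul1g //; exists x => //; rewrite mul1g.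
  rewrite big_cons.
  have -> : [set (g * \prod_(h <- w) h * x)%g | x in A] =
      [set (g * x)%g | x in [set (\prod_(h <- w) h * x)%g | x in A]].
    apply/seteqP; split => [y [x Ax <-]|y [_ [x Ax <-] <-]].
      by exists (\prod_(h <- w) h * x)%g; [exists x|rewrite mulgA].
    by exists x => //; rewrite mulgA.
  apply: le_trans (gen_le _ _ _) _; first by apply: hw; rewrite inE eqxx.
  by apply: IH => h hh; apply: hw; rewrite inE hh orbT.
exists nu; split.
- move=> A; apply: (ler_cvg_to (@cvg_cst _ (0 : R) _ U _) (hnu A)).
  by apply: nearW => k; case/andP: (mu01 A k).
- have : mu setT @ U --> (1 : R).
    have -> : mu setT = cst 1.
      apply/funext => k; rewrite /mu /count.
      rewrite (_ : [fset x in _ | _]%fset = ball (n k)) ?divff ?gt_eqF //.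
      by apply/fsetP => x; rewrite !inE /= mem_set // andbT.
    exact: cvg_cst.
  by move=> h; apply: (cvg_unique _ (hnu setT) h).
- move=> A B AB0.
  have h : mu (A `|` B) @ U --> nu A + nu B.
    have -> : mu (A `|` B) = (fun k => mu A k + mu B k).
      apply/funext => k; rewrite /mu -mulrDl; congr (_ / _); rewrite /count -natrD.
      congr (_%:R); rewrite -cardfsUI.
      rewrite (_ : (_ `&` _)%fset = fset0) ?cardfs0 ?addn0.
        congr #|` _|; apply/fsetP => x; rewrite !inE /= -andb_orr; congr (_ && _).
        apply/idP/orP => [/set_mem[]/mem_set|[]/set_mem] h;
          by [left|right|apply/mem_set; left|apply/mem_set; right].
      apply/fsetP => x; rewrite !inE /=; apply/negP => /andP[/andP[_ xA] /andP[_ xB]].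
      have xAB : (A `&` B) x by split; apply: set_mem.
      by rewrite AB0 in xAB.
    exact: cvgD.
  exact: (cvg_unique _ (hnu _) h).
- move=> g A; apply/eqP; rewrite eq_le gen_le' /=.
  have {1}-> : A = [set (g^-1 * x)%g | x in [set (g * x)%g | x in A]].
    apply/seteqP; split => [x Ax|y [_ [x Ax <-] <-]]; last by rewrite mulKg.
    by exists (g * x)%g; [exists x|rewrite mulKg].
  exact: gen_le'.
Qed.

End Growth.

(** * Splitting and concatenating spheres *)

Section Comparison.
Variables (R : realType) (G : groupType).

Lemma finite_set_bound (T : choiceType) (A : set T) (f : T -> R) :
  finite_set A -> exists2 K : R, 0 <= K & forall x, A x -> f x <= K.
Proof.
move=> fA; exists (\sum_(x <- fset_set A) `|f x|); first exact: sumr_ge0.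
move=> x Ax; apply: le_trans (ler_norm _) _.
rewrite (big_fsetD1 x) /=; last by rewrite in_fset_set // mem_set.
by rewrite lerDl sumr_ge0.
Qed.

Lemma subadditive_le_word_length (S : set G) (f : G -> R) :
  finite_symmetric_generators S -> f 1%g <= 0 ->
  (forall x y, f (x * y)%g <= f x + f y) ->
  exists2 K : R, 0 <= K & forall x, f x <= K * (word_length S x)%:R.
Proof.
move=> hS f1 fM; have [fS _ _] := hS; have [K K0 hK] := finite_set_bound f fS.
exists K => // x; have [[w [<- + ->]] _] := word_lengthP hS x.
elim: w => [|g w IH] hw; first by rewrite big_nil mulr0.
rewrite big_cons /= -natr1 mulrDr mulr1 addrC; apply: le_trans (fM _ _) _.
apply: lerD; first by apply: hK; apply: hw; rewrite inE eqxx.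
by apply: IH => h hh; apply: hw; rewrite inE hh orbT.
Qed.

Variables (S : set G) (d : G -> G -> R).
Hypothesis hS : finite_symmetric_generators S.
Hypothesis hd : D_metric d.

Lemma left_invariantE x y : d x y = d 1%g (x^-1 * y)%g.
Proof. by have [_ inv _ _] := hd; rewrite -(inv x^-1%g) mulVg. Qed.

(** [D_metric] compares [d] with the word metric of some generating set only, so generators have to
    be changed. Subadditivity gives the upper bound without additive constant, which later bounds
    each step of a path by L. *)
Lemma word_metric_comparison : exists L C : R, [/\ 1 <= L, 0 <= C &
  forall x y, d x y <= L * (word_length S (x^-1 * y)%g)%:R /\
    (word_length S (x^-1 * y)%g)%:R <= L * d x y + C].
Proof.
have [[dge0 d0 dC dT] _ _ [S' hS' [L' [C' [L'0 C'0 qi]]]]] := hd.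
have [|x y|K K0 hK] := @subadditive_le_word_length S (d 1%g) hS.
- by rewrite (d0 1%g 1%g).2.
- apply: le_trans (dT 1%g x _) _; rewrite lerD2l.
  by rewrite left_invariantE mulKg.
have [|x y|K' K'0 hK'] := @subadditive_le_word_length S' (fun x => (word_length S x)%:R) hS'.
- by rewrite (word_length1 hS).
- by rewrite -natrD ler_nat word_lengthM.
exists (1 + K + K' * L'), (K' * C').
have K'L' : 0 <= K' * L' by rewrite mulr_ge0 // ltW.
split; [lra|exact: mulr_ge0|move=> x y; split].
  rewrite left_invariantE; apply: le_trans (hK _) _.
  by rewrite ler_wpM2r //; lra.
apply: le_trans (hK' _) _.
have [_ h] := qi x y.
apply: le_trans (ler_wpM2l K'0 h) _.
rewrite mulrDr mulrA lerD2r ler_wpM2r //; lra.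
Qed.

End Comparison.

(** * Shadows, connecting elements and concatenation *)

Section Geometry.
Variables (R : realType) (G : groupType) (S : set G) (d : G -> G -> R).
Hypothesis hS : finite_symmetric_generators S.
Hypothesis hd : D_metric d.
Variables (delta L C : R).
Hypothesis delta_ge0 : 0 <= delta.
Hypothesis hyp : forall x y z w, gromov_product d w x y >=
  Num.min (gromov_product d w x z) (gromov_product d w z y) - delta.
Hypothesis L_ge1 : 1 <= L.
Hypothesis C_ge0 : 0 <= C.
Hypothesis LC : forall x y, d x y <= L * (word_length S (x^-1 * y)%g)%:R /\
    (word_length S (x^-1 * y)%g)%:R <= L * d x y + C.

Local Notation len := (word_length S).
Local Notation gp := (gromov_product d).
Local Notation D := (d 1%g).

Let dm : is_metric d. Proof. by case: hd. Qed.
Let gpC := gromov_productC dm.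
Let gp_min := gromov_product_min hyp.
Let L0 : 0 <= L. Proof. by move: L_ge1; lra. Qed.
Let dC x y : d x y = d y x. Proof. by case: dm. Qed.
Let dtri x y z : d x z <= d x y + d y z. Proof. by case: dm. Qed.
Let d_ge0 x y : 0 <= d x y. Proof. by case: dm. Qed.
Let dE x y : d x y = D (x^-1 * y)%g := left_invariantE hd x y.
Let D1 : D 1%g = 0. Proof. by case: dm => _ h _ _; apply/h. Qed.

Let gp_inv g w x y : gp (g * w)%g (g * x)%g (g * y)%g = gp w x y.
Proof. by have [_ inv _ _] := hd; rewrite /gromov_product !inv. Qed.

Let DL x : D x <= L * (len x)%:R.
Proof. by have [+ _] := LC 1 x; rewrite invg1 mul1g. Qed.

Let lenD x : (len x)%:R <= L * D x + C.
Proof. by have [_] := LC 1 x; rewrite invg1 mul1g. Qed.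

Definition geodesic_to (p : nat -> G) (x : G) :=
  [/\ p 0%N = 1%g, p (len x) = x & forall i j, (i <= j)%N -> (j <= len x)%N ->
    len ((p i)^-1 * p j)%g = (j - i)%N].

Lemma geodesic_to_quasigeodesic p x :
  geodesic_to p x -> quasigeodesic d L C p (len x).
Proof. by move=> [_ _ pl] i j ij jx; have := LC (p i) (p j); rewrite pl. Qed.

Lemma geodesic_to_word_length p x i :
  geodesic_to p x -> (i <= len x)%N ->
  len (p i) = i /\ len ((p i)^-1 * x)%g = (len x - i)%N.
Proof.
move=> [p0 px pl] ix; split.
  by have := pl 0%N i (leq0n _) ix; rewrite p0 invg1 mul1g subn0.
by rewrite -{1}px pl.
Qed.

Lemma geodesic_to_stable : exists2 M : R, 0 <= M &
  forall p x k, geodesic_to p x -> (k <= len x)%N -> gp (p k) 1%g x <= M.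
Proof.
have [M M0 hM] := quasigeodesic_stable dm delta_ge0 hyp L_ge1 C_ge0.
exists M => // p x k gpx kx; have [p0 px _] := gpx.
by have := hM _ _ (geodesic_to_quasigeodesic gpx) 0%N k _ (leq0n _) kx (leqnn _); rewrite p0 px.
Qed.

Lemma geodesic_to_project (A : R) : exists E : nat,
  forall p x q, geodesic_to p x -> gp q 1%g x <= A ->
    exists2 k, (k <= len x)%N & (len (q^-1 * p k)%g <= E)%N.
Proof.
have [B B0 hB] := quasigeodesic_project dm delta_ge0 hyp L_ge1 C_ge0.
exists (Num.truncn (L * (B + 2 * A) + C)) => p x q gpx hq.
have [p0 px _] := gpx.
have [|k kx hk] := hB _ _ (geodesic_to_quasigeodesic gpx) q A.
  by rewrite p0 px.
exists k => //; have [_ h] := LC q (p k).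
have h2 : (len (q^-1 * p k)%g)%:R <= L * (B + 2 * A) + C.
  by apply: le_trans h _; rewrite lerD2r ler_wpM2l.
by rewrite truncn_ge_nat // (le_trans _ h2).
Qed.

(** q lies at bounded distance from a geodesic to x, along which word lengths add up exactly. *)
Lemma word_length_almost_additive (A : R) : exists E : nat,
  forall x q, gp q 1%g x <= A -> (len q + len (q^-1 * x)%g <= len x + 2 * E)%N.
Proof.
have [E hE] := geodesic_to_project A; exists E => x q hq.
have [p gpx] := geodesic_exists hS x.
have [k kx hk] := hE p x q gpx hq.
have [h1 h2] := geodesic_to_word_length gpx kx.
have h3 : (len q <= len (p k) + E)%N.
  have -> : q = (p k * (q^-1 * p k)^-1)%g by rewrite invgM invgK mulVKg.
  by rewrite (leq_trans (word_lengthM hS _ _)) // leq_add2l word_lengthV.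
have h4 : (len (q^-1 * x)%g <= E + len ((p k)^-1 * x)%g)%N.
  have -> : (q^-1 * x = (q^-1 * p k) * ((p k)^-1 * x))%g by rewrite mulgA mulgK.
  by rewrite (leq_trans (word_lengthM hS _ _)) // leq_add2r.
by lia.
Qed.

Lemma sphere_split : exists2 C1 : R, 0 <= C1 & forall n m, exists f : G -> G * G,
  {in wsphere S (n + m) &, injective f} /\
  forall x, x \in wsphere S (n + m) ->
    [/\ (f x).1 \in wsphere S n, (f x).2 \in wsphere S m &
        `|D x - (D (f x).1 + D (f x).2)| <= C1].
Proof.
have [M M0 hM] := geodesic_to_stable.
have [p hp] := choice (geodesic_exists hS).
exists (2 * M); first by lra.
move=> n m; exists (fun x => (p x n, (p x n)^-1 * x)%g); split.
  by move=> x y _ _ [-> /mulgI].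
move=> x; rewrite !(in_wsphere hS) => /eqP xE /=.
have nx : (n <= len x)%N by rewrite xE leq_addr.
have [h1 h2] := geodesic_to_word_length (hp x) nx.
split; [by rewrite h1|by rewrite h2 xE addKn|].
rewrite -dE; have := hM _ _ _ (hp x) nx.
have := gromov_product_ge0 dm (p x n) 1%g x.
rewrite /gromov_product (dC (p x n) 1%g) => h3 h4.
by rewrite ler_norml; lra.
Qed.

Lemma geodesic_height p x (c : R) : geodesic_to p x -> 0 <= c -> c <= D x ->
  exists2 i, (i <= len x)%N & c <= D (p i) <= c + L.
Proof.
move=> gpx c0 cD; have [p0 px pl] := gpx.
have exi : exists i, (i <= len x)%N && (c <= D (p i)).
  by exists (len x); rewrite leqnn px.
case: (ex_minnP exi) => i /andP[ix ci] imin; exists i => //; rewrite ci /=.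
case: i ix ci imin => [|i] ix ci imin; first by rewrite p0 D1; move: L_ge1; lra.
have lt : D (p i) < c.
  rewrite ltNge; apply/negP => h.
  by have := imin i; rewrite h (ltnW ix) => /(_ isT); rewrite ltnn.
have [+ _] := LC (p i) (p i.+1).
by rewrite pl // subSnn mulr1; have := dtri 1%g (p i) (p i.+1); lra.
Qed.

(* Geodesics to two points of the same shadow fellow-travel up to height [c], so
   the points of a shadow lie in a translate of a ball of radius about [n - c/L]. *)
Lemma shadow_card (t : nat) : exists2 c : R, 0 <= c & forall a n, (t <= n)%N ->
  (#|` [fset z in wball S n | (c <= gp 1%g a z)%R]%fset| <= #|` wball S (n - t)|)%N.
Proof.
have [M M0 hM] := geodesic_to_stable.
(* [e] bounds the word distance between the points where the geodesics to [a] and to a point of its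
   shadow pass height [c]. Height [c] is reached only after t + e letters, so at least t letters are
   saved. *)
pose e := L * (2 * L + 2 * M + 4 * delta) + C.
have e0 : 0 <= e by rewrite /e addr_ge0 // mulr_ge0 //; move: L_ge1 delta_ge0; lra.
pose c := L * (t%:R + e).
have c0 : 0 <= c by rewrite mulr_ge0 // addr_ge0.
have height p x : geodesic_to p x -> c <= D x -> exists i,
    [/\ (i <= len x)%N, c <= D (p i) <= c + L & c - M <= gp 1%g (p i) x].
  move=> gpx cx; have [i ix /andP[ci1 ci2]] := geodesic_height gpx c0 cx.
  exists i; split; rewrite ?ci1 // (gromov_product_base dm).
  by have := hM _ _ _ gpx ix; lra.
exists c => // a n tn.
have [ca|ca] := leP c (D a); last first.
  rewrite (_ : [fset z in _ | _]%fset = fset0) ?cardfs0 //.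
  apply/fsetP => z; rewrite !inE /=; apply/negbTE/negP => /andP[_ h].
  by have := gromov_product_le dm 1%g a z; lra.
have [p gpa] := geodesic_exists hS a.
have [i [ia /andP[i1 i2] i3]] := height _ _ gpa ca.
apply: (@leq_trans #|` (fun z => (p i * z)%g) @` wball S (n - t)|%fset).
  apply: fsubset_leq_card; apply/fsubsetP => z; rewrite !inE /= => /andP[zn cz].
  apply/imfsetP; exists ((p i)^-1 * z)%g; last by rewrite mulVKg.
  rewrite /= (in_wball hS); move: zn; rewrite (in_wball hS) => zn.
  have cz' : c <= D z by apply: le_trans cz _; rewrite gpC (gromov_product_le dm).
  have [q gqz] := geodesic_exists hS z.
  have [j [jz /andP[j1 j2] j3]] := height _ _ gqz cz'.
  have [qj1 qj2] := geodesic_to_word_length gqz jz.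
  have h1 : c - M - delta <= gp 1%g (p i) z.
    by apply: (@gp_min _ _ a) => //; move: M0; lra.
  have h2 : c - M - 2 * delta <= gp 1%g (p i) (q j).
    have := @gp_min 1%g (p i) z (q j) (c - M - delta) h1.
    by rewrite (gpC _ z); move: delta_ge0; lra.
  have h3 := gromov_product_dist d 1%g (p i) (q j).
  have [_ h4] := LC (p i) (q j).
  have h5 : (len ((p i)^-1 * q j)%g)%:R <= e.
    by apply: le_trans h4 _; rewrite /e lerD2r ler_wpM2l //; lra.
  have h6 : t%:R + e <= j%:R.
    have := DL (q j); rewrite qj1 => h.
    have := le_trans j1 h; rewrite /c ler_pM2l //; by move: L_ge1; lra.
  have h7 : (t + len ((p i)^-1 * q j)%g <= j)%N by rewrite -(ler_nat R) natrD; lra.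
  have -> : ((p i)^-1 * z = (p i)^-1 * q j * ((q j)^-1 * z))%g by rewrite mulgA mulgK.
  apply: leq_trans (word_lengthM hS _ _) _; rewrite qj2.
  by clear -h7 jz zn; lia.
exact: leq_imfset_card.
Qed.

Hypothesis growth : exists2 eps : R, 0 < eps &
  forall n, (1 + eps) * #|` wball S n|%:R <= #|` wball S n.+1|%:R.

(** Bernoulli's form of exponential growth; it serves the choice of connecting elements and, later,
    the averages over balls. *)
Lemma wball_growth_linear : exists2 eps : R, 0 < eps & forall n t,
  (1 + t%:R * eps) * #|` wball S n|%:R <= #|` wball S (n + t)|%:R.
Proof.
have [eps eps0 heps] := growth; exists eps => // n t.
elim: t => [|t IH]; first by rewrite mul0r addr0 mul1r addn0.
rewrite addnS; apply: le_trans (heps _).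
have h : (1 + eps) * ((1 + t%:R * eps) * #|` wball S n|%:R) <=
    (1 + eps) * #|` wball S (n + t)|%:R by rewrite ler_wpM2l //; lra.
apply: le_trans h; rewrite mulrA ler_wpM2r // -natr1.
have : 0 <= t%:R * eps * eps by rewrite !mulr_ge0 // ltW.
by lra.
Qed.

Lemma wball_growth_iter : exists t : nat, forall n,
  (3 * #|` wball S n| < #|` wball S (n + t)|)%N.
Proof.
have [eps eps0 iter] := wball_growth_linear.
exists (Num.truncn (2 / eps)).+1 => n.
rewrite -(ltr_nat R) natrM; apply: lt_le_trans (iter n _).
rewrite ltr_pM2r ?ltr0n ?card_wball_gt0 //.
have : 2 / eps < (Num.truncn (2 / eps)).+1%:R by exact: truncnS_gt.
by rewrite ltr_pdivrMr //; lra.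
Qed.

(* Less than a third of a large ball lies in the shadow of [a], or in the inverse
   of the shadow of [b], or in a much smaller ball. *)
Lemma connecting_element : exists2 c : R, 0 <= c & forall B : nat,
  exists n, forall a b, exists z,
    [/\ (B < len z <= n)%N, gp 1%g a z < c & gp 1%g b z^-1%g < c].
Proof.
have [t ht] := wball_growth_iter; have [c c0 hc] := shadow_card t.
exists c => // B; exists (B + t)%N => a b; apply: contrapT => hno.
pose sh a := [fset z in wball S (B + t) | c <= gp 1%g a z]%fset.
have shle a' : (#|` sh a'| <= #|` wball S B|)%N.
  by have := hc a' (B + t)%N (leq_addl _ _); rewrite addnK.
have : (wball S (B + t) `<=` wball S B `|` (sh a `|` (fun z => z^-1%g) @` sh b))%fset.
  apply/fsubsetP => z zn; rewrite !inE; apply: contrapT => /negP.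
  rewrite !negb_or => /and3P[zB za zb]; apply: hno; exists z; split.
  - by rewrite -(in_wball hS (B + t)) zn andbT ltnNge -(in_wball hS).
  - have : ~~ ((z \in wball S (B + t)) && (c <= gp 1%g a z)) := za.
    by rewrite zn /= -ltNge.
  - rewrite ltNge; apply/negP => h; move/negP: zb; apply; apply/imfsetP.
    exists z^-1%g; last by rewrite invgK.
    by rewrite !inE /= h andbT (in_wball hS) (word_lengthV hS) -(in_wball hS).
move/fsubset_leq_card; apply/negP; rewrite -ltnNge.
apply: leq_ltn_trans (ht B); rewrite (mulnDl 1 2) mul1n mulSn mul1n.
apply: leq_trans (leq_card_fsetU _ _) _; rewrite leq_add2l.
apply: leq_trans (leq_card_fsetU _ _) _; apply: leq_add => //.
apply: leq_trans (leq_imfset_card _ _ _) _; exact: shle.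
Qed.

(** Seen from [p1], the points [p2] and [p3] agree up to height c + delta because the middle segment
    is long. A large product of [p0] and [p3] would thus force a large one of [p0] and [p2]. *)
Lemma broken_line_product (p0 p1 p2 p3 : G) (c : R) :
  gp p1 p0 p2 < c -> gp p2 p1 p3 < c -> 2 * c + delta <= d p1 p2 ->
  gp p1 p0 p3 <= c + delta.
Proof.
move=> h1 h2 h3; rewrite leNgt; apply/negP => h.
have h4 : c + delta <= gp p1 p3 p2 by rewrite gpC (gromov_product_base dm); lra.
by have := gp_min (ltW h) h4; lra.
Qed.

(** The product x z y, with z a connecting element, is cut back to length n + m along a chosen
    geodesic. The code keeps the removed tail, the displacement of x from the geodesic at time n,
    and z: the tail restores the product, the displacement then restores x, and z restores y. *)
Lemma sphere_concat : exists (C2 : R) (codes : seq (G * G * G)), 0 <= C2 /\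
  forall n m, exists (phi : G -> G -> G) (kappa : G -> G -> G * G * G),
  (forall x y x' y', x \in wsphere S n -> y \in wsphere S m ->
     x' \in wsphere S n -> y' \in wsphere S m ->
     phi x y = phi x' y' -> kappa x y = kappa x' y' -> x = x' /\ y = y') /\
  forall x y, x \in wsphere S n -> y \in wsphere S m ->
    [/\ phi x y \in wsphere S (n + m), kappa x y \in codes &
        `|D (phi x y) - (D x + D y)| <= C2].
Proof.
have [c c0 hc] := connecting_element.
have [E hE] := geodesic_to_project (c + delta).
have [E' hE'] := word_length_almost_additive (c + delta).
(* A length above B makes D z at least 2c + delta, so that the middle segment is long enough. The
   extra 4 E' outweighs the length lost at the two junctions, so the product has length at least n +
   m. *)
pose B := Num.truncn (L * (2 * c + delta) + C) .
have [N hN] := hc (B + 4 * E')%N.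
have /choice[zf hz] : forall xy : G * G, exists z,
    [/\ (B + 4 * E' < len z <= N)%N, gp 1%g xy.1^-1%g z < c & gp 1%g xy.2 z^-1%g < c].
  by move=> [x y]; exact: hN.
have [p hp] := choice (geodesic_exists hS).
pose w x y := (x * zf (x, y) * y)%g.
have main x y : let z := zf (x, y) in
    [/\ (len x + len y <= len (w x y) <= len x + len y + N)%N,
        gp x 1%g (w x y) <= c + delta &
        `|D (w x y) - (D x + D y)| <= L * N%:R + 4 * c + 2 * delta].
  move=> z; have [/= /andP[z1 z2] z3 z4] := hz (x, y); rewrite -/z in z1 z2 z3 z4.
  have Dz : 2 * c + delta <= D z.
    have h : L * (2 * c + delta) + C < (len z)%:R.
      apply: lt_le_trans (_ : B.+1%:R <= _); first exact: truncnS_gt.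
      by rewrite ler_nat; natlia.
    have := lt_le_trans h (lenD z); rewrite ltrD2r ltr_pM2l; first by lra.
    by move: L_ge1; lra.
  have g1 : gp x 1%g (x * z)%g < c.
    by rewrite -(gp_inv x^-1%g) mulVg mulg1 mulKg.
  have g2 : gp (x * z)%g x (w x y) < c.
    rewrite -(gp_inv (x * z)^-1%g) mulVg /w mulKg invgM mulgVK -/z gpC.
    exact: z4.
  have dxz : d x (x * z)%g = D z by rewrite dE mulKg.
  have g3 : gp x 1%g (w x y) <= c + delta.
    by apply: broken_line_product g1 g2 _; rewrite dxz.
  have g4 : gp z 1%g (z * y)%g <= c + delta.
    rewrite -(gp_inv z^-1%g) mulVg mulg1 mulKg gpC; apply: ltW.
    by apply: lt_le_trans z4 _; rewrite lerDl.
  have l1 := hE' _ _ g3; have l2 := hE' _ _ g4.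
  have wE : (w x y = x * (z * y))%g by rewrite /w mulgA.
  rewrite wE mulKg -wE in l1; rewrite mulKg in l2.
  have l3 := word_lengthM hS x (z * y)%g; rewrite -wE in l3.
  have l4 := word_lengthM hS z y.
  split => //; first by clear -l1 l2 l3 l4 z1 z2; lia.
  have d1 := gromov_product_dist d x 1%g (w x y).
  have d2 := gromov_product_dist d (x * z)%g x (w x y).
  have e1 : d x 1%g = D x by exact: dC.
  have e2 : d (x * z)%g x = D z by rewrite dC.
  have e3 : d (x * z)%g (w x y) = D y by rewrite dE /w mulKg.
  have p1 := gromov_product_ge0 dm x 1%g (w x y).
  have p2 := gromov_product_ge0 dm (x * z)%g x (w x y).
  have DzN : D z <= L * N%:R by apply: le_trans (DL z) _; rewrite ler_wpM2l // ler_nat.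
  have Dz0 := d_ge0 1%g z.
  have LN0 : 0 <= L * N%:R by exact: mulr_ge0.
  by rewrite ler_norml; move: delta_ge0; lra.
(* The radius E + E for the displacement: the geodesic to the product passes within E of x, at a
   time that differs from n by at most E. *)
pose codes := [seq (ab, c') | ab <- [seq (a, b) | a <- wball S N, b <- wball S (E + E)],
                              c' <- wball S N].
exists (2 * (L * N%:R) + 4 * c + 2 * delta), codes; split.
  by rewrite !addr_ge0 ?mulr_ge0.
move=> n m.
pose phi x y := p (w x y) (n + m)%N.
pose kappa x y := (((phi x y)^-1 * w x y)%g, ((p (w x y) n)^-1 * x)%g, zf (x, y)).
exists phi, kappa; split.
  move=> x y x' y' _ _ _ _ ephi [ew ex ez].
  have {}ew : w x y = w x' y' by move: ew; rewrite ephi => /mulgI.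
  have {}ex : x = x' by move: ex; rewrite ew => /mulgI.
  by split => //; move: ew; rewrite /w ez ex => /mulgI.
move=> x y; rewrite !(in_wsphere hS) => /eqP xn /eqP ym.
have [/andP[w1 w2] w3 w4] := main x y.
have nmw : (n + m <= len (w x y))%N by rewrite -xn -ym.
have [ph1 ph2] := geodesic_to_word_length (hp (w x y)) nmw.
have [z1 _ _] := hz (x, y).
split.
- by rewrite ph1.
- apply/allpairsP; exists (((phi x y)^-1 * w x y)%g, ((p (w x y) n)^-1 * x)%g, zf (x, y)).
  split => //=; last by rewrite (in_wball hS); case/andP: z1.
  apply/allpairsP; exists (((phi x y)^-1 * w x y)%g, ((p (w x y) n)^-1 * x)%g).
  split => //=; rewrite (in_wball hS).
    by rewrite ph2; clear -w1 w2 xn ym; lia.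
  have [k kw hk] := hE _ _ _ (hp (w x y)) w3.
  have nw : (n <= len (w x y))%N by apply: leq_trans nmw; exact: leq_addr.
  have [k1 _] := geodesic_to_word_length (hp (w x y)) kw.
  have kx : (k <= len x + E)%N /\ (len x <= k + E)%N.
    split.
      rewrite -{1}k1; have -> : p (w x y) k = (x * (x^-1 * p (w x y) k))%g by rewrite mulVKg.
      by apply: leq_trans (word_lengthM hS _ _) _; rewrite leq_add2l.
    rewrite -{1}k1; have {1}-> : x = (p (w x y) k * (x^-1 * p (w x y) k)^-1)%g.
      by rewrite invgM invgK mulVKg.
    apply: leq_trans (word_lengthM hS _ _) _; rewrite leq_add2l.
    by rewrite (word_lengthV hS).
  have nk : (len ((p (w x y) n)^-1 * p (w x y) k)%g <= E)%N.
    have [_ _ pl] := hp (w x y).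
    have [nk|kn] := leqP n k; first by rewrite pl //; clear -kx xn; lia.
    rewrite -(word_lengthV hS) invgM invgK pl //; last exact: ltnW.
    by clear -kx xn; lia.
  have -> : ((p (w x y) n)^-1 * x = ((p (w x y) n)^-1 * p (w x y) k) *
      (x^-1 * p (w x y) k)^-1)%g by rewrite invgM invgK mulgA mulgK.
  apply: leq_trans (word_lengthM hS _ _) _; apply: leq_add => //.
  by rewrite (word_lengthV hS).
have : d (phi x y) (w x y) <= L * N%:R.
  have [+ _] := LC (phi x y) (w x y); rewrite ph2 => /le_trans; apply.
  by rewrite ler_wpM2l // ler_nat; clear -w1 w2 xn ym; lia.
have := dtri 1%g (phi x y) (w x y); have := dtri 1%g (w x y) (phi x y).
rewrite (dC (w x y) (phi x y)); move: w4; rewrite !ler_norml; lra.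
Qed.

End Geometry.

(** * Partition functions and pressure *)

Lemma ler_sum_inj (R : realType) (I J : eqType) (s : seq I) (r : seq J)
    (h : I -> J) (E : I -> R) (F : J -> R) :
  uniq s -> {in s &, injective h} -> (forall i, i \in s -> h i \in r) ->
  (forall j, 0 <= F j) -> (forall i, i \in s -> E i <= F (h i)) ->
  \sum_(i <- s) E i <= \sum_(j <- r) F j.
Proof.
elim: s r => [|i s IH] r; first by move=> *; rewrite big_nil sumr_ge0.
rewrite /= => /andP[is_ us] hinj hr F0 EF.
rewrite big_cons (big_rem (h i)) /=; last by apply: hr; rewrite inE eqxx.
apply: lerD; first by apply: EF; rewrite inE eqxx.
apply: IH => //.
- by move=> x y xs ys; apply: hinj; rewrite inE ?xs ?ys orbT.
- move=> j js; have hj : h j \in r by apply: hr; rewrite inE js orbT.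
  have := perm_mem (perm_to_rem (hr i (mem_head _ _))) (h j).
  rewrite hj inE => /esym/orP[/eqP hij|//].
  have /hinj := hij; rewrite !inE js eqxx orbT => /(_ isT isT) ji.
  by move: is_; rewrite -ji js.
- by move=> j js; apply: EF; rewrite inE js orbT.
Qed.

(** Turns inequalities that hold for n times a quantity up to a bounded error into exact ones. *)
Lemma natmul_bounded_le0 (R : realType) (x c : R) :
  (forall n : nat, n%:R * x <= c) -> x <= 0.
Proof.
move=> h; rewrite leNgt; apply/negP => x0.
have := h (Num.truncn (c / x)).+1; apply/negP; rewrite -ltNge -ltr_pdivrMr //.
exact: truncnS_gt.
Qed.

(** Comparison at the index n m shows that every lower quotient (a n - c) / n is at most every upper
    quotient (a m + c) / m. The supremum of the former separates the two families. *)
Lemma almost_additive_slope (R : realType) (a : nat -> R) (c : R) :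
  (forall n m, `|a (n + m)%N - (a n + a m)| <= c) ->
  exists l, forall n, `|a n - n%:R * l| <= c.
Proof.
move=> ha.
have hmul n m : `|a (n * m.+1)%N - m.+1%:R * a n| <= m.+1%:R * c.
  elim: m => [|m IH].
    by rewrite muln1 !mul1r subrr normr0; apply: le_trans (ha 0%N 0%N).
  rewrite mulnS addnC -[m.+2%:R]natr1.
  by move: (ha (n * m.+1)%N n) IH; rewrite !ler_norml; lra.
have cross n m : (a n.+1 - c) / n.+1%:R <= (a m.+1 + c) / m.+1%:R.
  rewrite ler_pdivrMr // mulrAC ler_pdivlMr //.
  have := hmul n.+1 m; have := hmul m.+1 n; rewrite mulnC !ler_norml.
  by lra.
pose E := [set (a n.+1 - c) / n.+1%:R | n in [set: nat]].
have E0 : E !=set0 by exists ((a 1%N - c) / 1%:R); exists 0%N.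
have Eub : has_ubound E by exists ((a 1%N + c) / 1%:R) => _ [n _ <-]; exact: cross.
exists (sup E) => -[|n].
  by rewrite mul0r subr0 -normrN; have := ha 0%N 0%N; rewrite addn0 opprD addrA subrr add0r.
have h1 : (a n.+1 - c) / n.+1%:R <= sup E by apply: ub_le_sup => //; exists n.
have h2 : sup E <= (a n.+1 + c) / n.+1%:R.
  by apply: ge_sup => // _ [m _ <-]; exact: cross.
move: h1 h2; rewrite ler_pdivrMr // ler_pdivlMr // ler_norml.
by lra.
Qed.

Section QuasiAdditive.
Variables (R : realType) (T : choiceType) (T' : eqType) (Sn : nat -> seq T) (D : T -> R).
Variables (L C : R) (codes : seq T').

(* Abstract form of the splitting and concatenation of spheres: up to bounded
   multiplicity, [Sn (n + m)] is [Sn n * Sn m], with [D] additive up to [C]. *)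
Definition quasi_additive := [/\
  0 <= L /\ 0 <= C,
  forall n, uniq (Sn n) /\ Sn n != [::],
  forall n x, x \in Sn n -> `|D x| <= L * n%:R,
  forall n m, exists f : T -> T * T, {in Sn (n + m)%N &, injective f} /\
    forall x, x \in Sn (n + m)%N -> [/\ (f x).1 \in Sn n, (f x).2 \in Sn m &
      `|D x - (D (f x).1 + D (f x).2)| <= C] &
  forall n m, exists (phi : T -> T -> T) (kappa : T -> T -> T'),
    (forall x y x' y', x \in Sn n -> y \in Sn m -> x' \in Sn n -> y' \in Sn m ->
       phi x y = phi x' y' -> kappa x y = kappa x' y' -> x = x' /\ y = y') /\
    forall x y, x \in Sn n -> y \in Sn m ->
      [/\ phi x y \in Sn (n + m)%N, kappa x y \in codes &
          `|D (phi x y) - (D x + D y)| <= C]].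

Definition partition_fun (n : nat) (t : R) (A : pred R) : R :=
  \sum_(x <- Sn n | A (D x)) expR (t * D x).

Local Notation Z := partition_fun.
Local Notation ZT n t := (partition_fun n t predT).
Local Notation K := ((size codes)%:R : R).

Hypothesis qa : quasi_additive.

Let L0 : 0 <= L. Proof. by case: qa => -[]. Qed.
Let C0 : 0 <= C. Proof. by case: qa => -[]. Qed.

Lemma partition_fun_ge0 n t A : 0 <= Z n t A.
Proof. by apply: sumr_ge0 => x _; exact: expR_ge0. Qed.

Lemma ler_partition_fun n (A B : pred R) (t t' e : R) :
  (forall x, x \in Sn n -> A (D x) -> B (D x) /\ expR (t * D x) <= expR e * expR (t' * D x)) ->
  Z n t A <= expR e * Z n t' B.
Proof.
move=> AB; rewrite /Z mulr_sumr big_mkcond [leRHS]big_mkcond /=.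
rewrite big_seq [leRHS]big_seq; apply: ler_sum => x xn.
case: ifP => [Ax|_]; first by have [-> h] := AB x xn Ax.
by case: ifP => // _; rewrite mulr_ge0 // expR_ge0.
Qed.

Lemma partition_fun_mono n t (A B : pred R) : (forall r, A r -> B r) -> Z n t A <= Z n t B.
Proof.
move=> AB; rewrite -[leRHS]mul1r -expR0; apply: ler_partition_fun => x _ /AB ->.
by rewrite expR0 mul1r.
Qed.

Lemma partition_fun_gt0 n t : 0 < ZT n t.
Proof.
have [_ /(_ n)[_ ne] _ _ _] := qa; rewrite /Z; case: (Sn n) ne => // x s _.
by rewrite big_cons ltr_pwDl ?expR_gt0 // sumr_ge0 // => y _; exact: expR_ge0.
Qed.

Lemma expR_almost (t : R) (a b : R) : `|a - b| <= C ->
  expR (t * a) <= expR (`|t| * C) * expR (t * b).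
Proof.
move=> ab; rewrite -expRD ler_expR -lerBlDr -mulrBr.
by apply: le_trans (ler_norm _) _; rewrite normrM ler_wpM2l.
Qed.

Lemma partition_fun_submult n m t :
  ZT (n + m) t <= expR (`|t| * C) * (ZT n t * ZT m t).
Proof.
have [_ /(_ (n + m)%N)[us _] _ /(_ n m)[f [finj hf]] _] := qa.
rewrite /Z /= big_distrlr /= mulr_sumr.
have -> : \sum_(i <- Sn n) expR (`|t| * C) * \sum_(j <- Sn m) expR (t * D i) * expR (t * D j)
   = \sum_(p <- [seq (i, j) | i <- Sn n, j <- Sn m])
      expR (`|t| * C) * expR (t * (D p.1 + D p.2)).
  rewrite big_allpairs; apply: eq_bigr => i _; rewrite mulr_sumr.
  by apply: eq_bigr => j _; rewrite mulrDr expRD.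
apply: (ler_sum_inj us finj).
- move=> x /hf[h1 h2 _]; apply/allpairsP; exists (f x); split => //.
  by rewrite -surjective_pairing.
- by move=> p; rewrite mulr_ge0 ?expR_ge0.
- by move=> x /hf[_ _ h]; exact: expR_almost.
Qed.

(** Concatenation becomes injective when paired with its code, at the price of the factor [K]. The
    predicates follow the values of [D] through it: this is how mass is carried to intermediate
    slopes. *)
Lemma partition_fun_supermult n m t (A B W : pred R) :
  (forall r1 r2 r, A r1 -> B r2 -> `|r - (r1 + r2)| <= C -> W r) ->
  Z n t A * Z m t B <= K * (expR (`|t| * C) * Z (n + m) t W).
Proof.
move=> ABW.
have [_ hu _ _ /(_ n m)[phi [kappa [inj hphi]]]] := qa.
have [[un _] [um _]] := (hu n, hu m).
rewrite /Z -(big_filter (Sn n)) -(big_filter (Sn m)) -(big_filter (Sn (n + m)%N)).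
rewrite big_distrlr /=.
set sA := [seq i <- Sn n | _]; set sB := [seq i <- Sn m | _].
set sW := [seq i <- Sn (n + m)%N | _].
have -> : \sum_(i <- sA) \sum_(j <- sB) expR (t * D i) * expR (t * D j) =
    \sum_(p <- [seq (i, j) | i <- sA, j <- sB]) expR (t * (D p.1 + D p.2)).
  rewrite big_allpairs; apply: eq_bigr => i _; apply: eq_bigr => j _ /=.
  by rewrite -expRD mulrDr.
have -> : K * (expR (`|t| * C) * \sum_(i <- sW) expR (t * D i)) =
    \sum_(p <- [seq (i, j) | i <- sW, j <- codes]) expR (`|t| * C) * expR (t * D p.1).
  rewrite big_allpairs mulrA mulr_sumr; apply: eq_bigr => i _ /=.
  by rewrite [RHS]big_const_seq count_predT iter_addr_0 -[RHS]mulr_natl mulrA.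
have mem p : p \in [seq (i, j) | i <- sA, j <- sB] ->
    [/\ p.1 \in Sn n, p.2 \in Sn m, A (D p.1) & B (D p.2)].
  by move=> /allpairsP[q []]; rewrite !mem_filter => /andP[? ?] /andP[? ?] ->.
apply: (@ler_sum_inj _ _ _ _ _ (fun p => (phi p.1 p.2, kappa p.1 p.2))).
- apply: allpairs_uniq; [exact: filter_uniq|exact: filter_uniq|].
  by move=> [? ?] [? ?].
- move=> [x y] [x' y'] /mem[/= xn ym _ _] /mem[/= xn' ym' _ _] [e1 e2].
  by have [-> ->] := inj _ _ _ _ xn ym xn' ym' e1 e2.
- move=> p /mem[p1 p2 Ap Bp]; have [h1 h2 h3] := hphi _ _ p1 p2.
  apply/allpairsP; exists (phi p.1 p.2, kappa p.1 p.2); split => //=.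
  by rewrite mem_filter h1 andbT; exact: ABW h3.
- by move=> p; rewrite mulr_ge0 ?expR_ge0.
- move=> p /mem[p1 p2 Ap Bp]; have [h1 h2 h3] := hphi _ _ p1 p2.
  by apply: expR_almost; rewrite distrC.
Qed.

Lemma codes_ge1 : 1 <= K.
Proof.
have [_ /(_ 0%N)[_ ne] _ _ /(_ 0%N 0%N)[phi [kappa [_ h]]]] := qa.
case: (Sn 0) ne h => // x s _ /(_ x x); rewrite inE eqxx => /(_ isT isT)[_ kc _].
by rewrite ler1n; case: codes kc.
Qed.

(** The logarithm of the multiplicativity constant. It is affine in |t|, hence bounded uniformly
    over tilts at distance at most 1. *)
Definition defect (t : R) : R := `|t| * C + ln K.

Lemma defect_ge0 t : 0 <= defect t.
Proof. by rewrite addr_ge0 ?mulr_ge0 // ln_ge0 // codes_ge1. Qed.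

Lemma pressure_exists : exists Lam : R -> R, forall t n,
  `|ln (ZT n t) - n%:R * Lam t| <= defect t.
Proof.
suff /choice[Lam hL] : forall t, exists l, forall n,
  `|ln (ZT n t) - n%:R * l| <= defect t by exists Lam.
move=> t; apply: (@almost_additive_slope R (fun n => ln (ZT n t))) => n m.
have K1 := codes_ge1.
have K0 : 0 < K by apply: lt_le_trans K1.
have Zn := partition_fun_gt0 n t; have Zm := partition_fun_gt0 m t.
have Znm := partition_fun_gt0 (n + m) t.
have h1 := partition_fun_submult n m t.
have h2 : ZT n t * ZT m t <= K * (expR (`|t| * C) * ZT (n + m) t).
  by apply: partition_fun_supermult.
move: h1 h2; rewrite -ler_ln ?posrE ?mulr_gt0 ?expR_gt0 //.
rewrite -(@ler_ln _ (_ * _) (_ * (_ * _))) ?posrE ?mulr_gt0 ?expR_gt0 //.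
rewrite !lnM ?posrE ?mulr_gt0 ?expR_gt0 // expRK /defect ler_norml => h1 h2.
have := ln_ge0 K1; have : 0 <= `|t| * C by rewrite mulr_ge0.
lra.
Qed.

Variable Lam : R -> R.
Hypothesis hLam : forall t n, `|ln (ZT n t) - n%:R * Lam t| <= defect t.

Lemma partition_fun_bounds n t :
  expR (n%:R * Lam t - defect t) <= ZT n t <= expR (n%:R * Lam t + defect t).
Proof.
rewrite -[ZT n t]lnK ?posrE ?partition_fun_gt0 // !ler_expR.
by have := hLam t n; rewrite ler_norml; lra.
Qed.

Lemma pressure_lipschitz t t' : Lam t' <= Lam t + L * `|t' - t|.
Proof.
suff : Lam t' - Lam t - L * `|t' - t| <= 0 by lra.
apply: (@natmul_bounded_le0 _ _ (defect t' + defect t)) => n.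
have [_ _ hL _ _] := qa.
have : ZT n t' <= expR (n%:R * (L * `|t' - t|)) * ZT n t.
  apply: ler_partition_fun => x xn _; split => //.
  rewrite -expRD ler_expR -lerBlDr -mulrBl; apply: le_trans (ler_norm _) _.
  by rewrite normrM mulrC mulrA (mulrC n%:R) ler_wpM2r // hL.
have /andP[h1 _] := partition_fun_bounds n t'.
have /andP[_ h2] := partition_fun_bounds n t.
move=> h3; have h4 : expR (n%:R * (L * `|t' - t|)) * ZT n t <=
    expR (n%:R * (L * `|t' - t|) + (n%:R * Lam t + defect t)).
  by rewrite expRD ler_wpM2l // expR_ge0.
by have := le_trans h1 (le_trans h3 h4); rewrite ler_expR; lra.
Qed.

Lemma expR_convex (l a b : R) : 0 <= l -> l <= 1 ->
  expR (l * a + (1 - l) * b) <= l * expR a + (1 - l) * expR b.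
Proof.
by move=> l0 l1; have := convex_expR (Itv01 l0 l1) a b; rewrite !convRE.
Qed.

(* Hoelder's inequality for the partition functions, from the convexity of
   [expR] applied to the normalised weights. *)
Lemma pressure_convex (l t t' : R) : 0 <= l -> l <= 1 ->
  Lam (l * t + (1 - l) * t') <= l * Lam t + (1 - l) * Lam t'.
Proof.
move=> l0 l1; set s := l * t + (1 - l) * t'.
suff : Lam s - (l * Lam t + (1 - l) * Lam t') <= 0 by lra.
apply: (@natmul_bounded_le0 _ _ (defect s + l * defect t + (1 - l) * defect t')) => n.
have Z1 := partition_fun_gt0 n t; have Z2 := partition_fun_gt0 n t'.
set z := l * ln (ZT n t) + (1 - l) * ln (ZT n t').
have : ZT n s <= expR z.
  have -> : ZT n s = expR z * \sum_(x <- Sn n) expR (s * D x - z).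
    by rewrite mulr_sumr; apply: eq_bigr => x _; rewrite -expRD; congr expR; ring.
  rewrite -[leRHS]mulr1 ler_wpM2l ?expR_ge0 //.
  have norm u : \sum_(x <- Sn n) expR (u * D x - ln (ZT n u)) = 1.
    have Zu := partition_fun_gt0 n u.
    under eq_bigr do rewrite expRD expRN lnK ?posrE //.
    by rewrite -mulr_suml divff // gt_eqF.
  have conv1 (a b : R) : a = 1 -> b = 1 -> l * a + (1 - l) * b = 1.
    by move=> -> ->; rewrite !mulr1 addrC subrK.
  have <- := conv1 _ _ (norm t) (norm t').
  rewrite !mulr_sumr -big_split /=; apply: ler_sum => x _.
  apply: le_trans (expR_convex _ _ l0 l1); rewrite ler_expR /s /z.
  by rewrite le_eqVlt; apply/orP; left; apply/eqP; ring.
have /andP[h1 _] := partition_fun_bounds n s.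
move=> /(le_trans h1); rewrite ler_expR /z.
have h2 : l * ln (ZT n t) <= l * (n%:R * Lam t + defect t).
  by rewrite ler_wpM2l //; have := hLam t n; rewrite ler_norml; lra.
have h3 : (1 - l) * ln (ZT n t') <= (1 - l) * (n%:R * Lam t' + defect t').
  by rewrite ler_wpM2l ?subr_ge0 //; have := hLam t' n; rewrite ler_norml; lra.
lra.
Qed.

(** * Chernoff bounds, windows and one-sided slopes *)

Lemma chernoff_ge n (t u a : R) : 0 <= u ->
  Z n t (fun r => a <= r) <= expR (- (u * a)) * ZT n (t + u).
Proof.
move=> u0; apply: ler_partition_fun => x _ ax; split => //.
rewrite -expRD ler_expR; have : u * a <= u * D x by rewrite ler_wpM2l.
lra.
Qed.

Lemma chernoff_le n (t u a : R) : 0 <= u ->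
  Z n t (fun r => r <= a) <= expR (u * a) * ZT n (t - u).
Proof.
move=> u0; apply: ler_partition_fun => x _ ax; split => //.
rewrite -expRD ler_expR; have : u * D x <= u * a by rewrite ler_wpM2l.
lra.
Qed.

Definition window (c w : R) : pred R := fun r => `|r - c| <= w.

Lemma partition_fun_split3 n (t c w : R) :
  ZT n t <= Z n t (fun r => r <= c - w) + Z n t (window c w) + Z n t (fun r => c + w <= r).
Proof.
rewrite /Z ![X in _ <= X + _ + _]big_mkcond ![X in _ <= _ + X + _]big_mkcond.
rewrite ![X in _ <= _ + _ + X]big_mkcond -!big_split /=; apply: ler_sum => x _.
have e0 := expR_ge0 (t * D x); rewrite /window.
case: (lerP (D x) (c - w)) => h1; case: (lerP (c + w) (D x)) => h2;
  case: ifPn => h3; try lra.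
by move/negP: h3; case; rewrite ler_norml; lra.
Qed.

(** The right derivative of a convex function, as a supporting half-line together with tangency up
    to any slope error. *)
Definition right_slope (t s : R) := (forall u : R, 0 <= u -> Lam t + s * u <= Lam (t + u)) /\
  forall eta : R, 0 < eta -> exists2 u0 : R, 0 < u0 & forall u : R, 0 <= u -> u <= u0 ->
    Lam (t + u) <= Lam t + (s + eta) * u.

(** The infimum of the difference quotients, finite by the Lipschitz bound; convexity carries a
    nearly minimal quotient at u0 over to all smaller u. *)
Lemma right_slope_exists t : exists s, right_slope t s.
Proof.
pose E := [set (Lam (t + u) - Lam t) / u | u in [set u | 0 < u]].
have E0 : E !=set0 by exists ((Lam (t + 1) - Lam t) / 1); exists 1 => /=.
have Elb : has_lbound E.
  exists (- L) => _ [u /= u0 <-]; rewrite ler_pdivlMr // mulNr.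
  have := pressure_lipschitz (t + u) t.
  by rewrite (_ : t - (t + u) = - u) ?normrN ?gtr0_norm //; [lra|ring].
exists (inf E); split.
  move=> u; rewrite le_eqVlt => /orP[/eqP<-|u0]; first by rewrite mulr0 !addr0.
  have : inf E <= (Lam (t + u) - Lam t) / u by apply: ge_inf => //; exists u.
  by rewrite ler_pdivlMr //; lra.
move=> eta eta0; have [_ [u0 /= u00 <-] h] := inf_adherent eta0 (conj E0 Elb).
exists u0 => // u u1 u2.
have {}h : Lam (t + u0) - Lam t <= (inf E + eta) * u0.
  by apply: ltW; rewrite -ltr_pdivrMr.
have l0 : 0 <= u / u0 by rewrite divr_ge0 // ltW.
have l1 : u / u0 <= 1 by rewrite ler_pdivrMr // mul1r.
have := pressure_convex (t + u0) t l0 l1.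
have -> : u / u0 * (t + u0) + (1 - u / u0) * t = t + u.
  by rewrite mulrDr divfK ?gt_eqF //; ring.
have : u / u0 * (Lam (t + u0) - Lam t) <= u / u0 * ((inf E + eta) * u0).
  by rewrite ler_wpM2l.
rewrite (_ : u / u0 * ((inf E + eta) * u0) = (inf E + eta) * u); last first.
  by rewrite mulrCA divfK ?gt_eqF.
lra.
Qed.

(* At scale [u = M / n] the exponential moments of [D] under the tilted measure
   are those of a point mass at [n s] up to constants; the size of [M] only
   depends on [eps], through [M * eps = kappa], so that the mass of the window
   is bounded below independently of [eps]. *)
Lemma right_slope_window t s : right_slope t s ->
  exists2 p : R, 0 < p & forall eps : R, 0 < eps -> exists n0 : nat, forall n, (n0 <= n)%N ->
    p * ZT n t <= Z n t (window (n%:R * s) (n%:R * eps)).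
Proof.
move=> [slope_le slope_ge].
pose c1 := (`|t| + 1) * C + ln K.
have c1_ge (u : R) : 0 <= u -> u <= 1 -> defect (t + u) <= c1.
  move=> u0 u1; rewrite lerD2r ler_wpM2r //.
  by apply: le_trans (ler_normD _ _) _; rewrite lerD2l ger0_norm.
(* 2 c1 pays for the defects of the two sums compared, 2 for the tangency error at the tilt 2u, and
   2 for a factor 4 <= e^2, which leaves each tail at most a quarter of [X]. *)
pose kappa := 2 * c1 + 4.
have c10 : 0 <= c1 by apply: le_trans (c1_ge 0 _ _); rewrite ?addr0 ?defect_ge0.
have kappa0 : 0 < kappa by rewrite /kappa; lra.
exists (expR (- 2 * c1 - kappa) / 2); first by rewrite divr_gt0 ?expR_gt0.
move=> eps eps0; pose M := kappa / eps.
have M0 : 0 < M by rewrite divr_gt0.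
have Meps : M * eps = kappa by rewrite divfK // gt_eqF.
(* With the slope error 1 / M, the error at the tilt 2u, multiplied by n, is 2 n u / M = 2. *)
have [u0 u00 hu0] := slope_ge (1 / M) (divr_gt0 ltr01 M0).
pose m := Num.min u0 1 / 2.
have m0 : 0 < m by rewrite divr_gt0 // lt_min u00 ltr01.
exists (Num.truncn (M / m)).+1 => n n0n.
have n0 : 0 < n%:R :> R by rewrite ltr0n; lia.
pose u := M / n%:R.
have u_gt0 : 0 < u by rewrite divr_gt0.
have um : u < m.
  rewrite ltr_pdivrMr // mulrC -ltr_pdivrMr //.
  by apply: lt_le_trans (truncnS_gt _) _; rewrite ler_nat.
have /andP[uu0 u1] : (u + u <= u0) && (u + u <= 1).
  by rewrite -le_min -[leRHS]divr1; move: um; rewrite /m ltr_pdivlMr //; lra.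
have nu : n%:R * u = M by rewrite mulrC divfK // gt_eqF.
set X := expR (n%:R * Lam t + M * s - c1).
have X0 : 0 < X by exact: expR_gt0.
have e2 : 2 <= expR 1 :> R by have := expR_ge1Dx (1 : R); lra.
have e4 (y : R) : 4 * expR (y - 2) <= expR y.
  rewrite (_ : expR y = expR (y - 2) * (expR 1 * expR 1)).
    by rewrite mulrC ler_wpM2l ?expR_ge0 //; nra.
  by rewrite -!expRD; congr expR; ring.
have hbound (v : R) : 0 <= v -> v <= 1 ->
    expR (n%:R * Lam (t + v) - c1) <= ZT n (t + v) <= expR (n%:R * Lam (t + v) + c1).
  move=> v0 v1; have := partition_fun_bounds n (t + v); have := c1_ge v v0 v1.
  move=> hc /andP[h1 h2]; apply/andP; split.
    by apply: le_trans h1; rewrite ler_expR; lra.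
  by apply: le_trans h2 _; rewrite ler_expR; lra.
have nLu : n%:R * (Lam t + s * u) <= n%:R * Lam (t + u).
  by apply: ler_wpM2l; [exact: ltW|apply: slope_le; exact: ltW].
have hX : X <= ZT n (t + u).
  have /andP[h _] : _ <= _ <= _ := hbound u (ltW u_gt0) ltac:(lra); apply: le_trans h.
  by rewrite ler_expR; move: nLu; rewrite mulrDr mulrCA nu; lra.
have low : 4 * Z n (t + u) (fun r => r <= n%:R * s - n%:R * eps) <= X.
  have h1 := chernoff_le n (t + u) (n%:R * s - n%:R * eps) (ltW u_gt0).
  have /andP[_ h2] := hbound 0 (lexx _) ler01.
  rewrite addrK in h1; rewrite addr0 in h2.
  have h3 : expR (u * (n%:R * s - n%:R * eps)) * ZT n t <=
      expR (M * s - kappa + (n%:R * Lam t + c1)).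
    rewrite expRD -Meps -nu (_ : u * _ = n%:R * u * s - n%:R * u * eps); last by ring.
    by rewrite ler_wpM2l ?expR_ge0.
  apply: le_trans (e4 _); rewrite ler_wpM2l //.
  by apply: le_trans h1 (le_trans h3 _); rewrite ler_expR /kappa; lra.
have high : 4 * Z n (t + u) (fun r => n%:R * s + n%:R * eps <= r) <= X.
  have h1 := chernoff_ge n (t + u) (n%:R * s + n%:R * eps) (ltW u_gt0).
  have uu : 0 <= u + u by lra.
  have /andP[_ h2] := hbound (u + u) uu u1; rewrite addrA in h2.
  have h3 : expR (- (u * (n%:R * s + n%:R * eps))) * ZT n (t + u + u) <=
      expR (- (M * s + kappa) + (n%:R * Lam (t + u + u) + c1)).
    rewrite expRD -Meps -nu.
    rewrite (_ : u * _ = n%:R * u * s + n%:R * u * eps); last by ring.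
    by rewrite ler_wpM2l ?expR_ge0.
  have h4 : n%:R * Lam (t + u + u) <= n%:R * Lam t + 2 * (M * s) + 2.
    have := hu0 (u + u) uu uu0; rewrite addrA => h.
    have : n%:R * Lam (t + u + u) <= n%:R * (Lam t + (s + 1 / M) * (u + u)).
      by apply: ler_wpM2l => //; exact: ltW.
    have -> : n%:R * (Lam t + (s + 1 / M) * (u + u)) =
        n%:R * Lam t + 2 * (n%:R * u * s) + 2 * (n%:R * u / M) by ring.
    by rewrite nu divff ?gt_eqF // mulr1.
  apply: le_trans (e4 _); rewrite ler_wpM2l //.
  by apply: le_trans h1 (le_trans h3 _); rewrite ler_expR /kappa; lra.
have mid := partition_fun_split3 n (t + u) (n%:R * s) (n%:R * eps).
have win : Z n (t + u) (window (n%:R * s) (n%:R * eps)) <=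
    expR (M * s + kappa) * Z n t (window (n%:R * s) (n%:R * eps)).
  apply: ler_partition_fun => x _ wx; split => //.
  rewrite -expRD ler_expR.
  have : u * D x <= u * (n%:R * s + n%:R * eps).
    by apply: ler_wpM2l; [exact: ltW|]; move: wx; rewrite /window ler_norml; lra.
  rewrite (_ : u * (_ + _) = n%:R * u * s + n%:R * u * eps); last by ring.
  by rewrite nu Meps; lra.
have hm : X <= 2 * (expR (M * s + kappa) * Z n t (window (n%:R * s) (n%:R * eps))) by lra.
have /andP[_ h0] := hbound 0 (lexx _) ler01; rewrite addr0 in h0.
have XE : X = expR (M * s + kappa) * (expR (- 2 * c1 - kappa) * expR (n%:R * Lam t + c1)).
  by rewrite -!expRD /X; congr expR; ring.
have : expR (M * s + kappa) * (expR (- 2 * c1 - kappa) * ZT n t) <= X.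
  by rewrite XE !ler_wpM2l ?expR_ge0.
rewrite mulrCA in hm; move=> /le_trans /(_ hm); rewrite ler_pM2l ?expR_gt0 //.
by rewrite -mulrA mulrCA; lra.
Qed.

End QuasiAdditive.

(** * Differentiability of the pressure *)

Section Differentiability.
Variables (R : realType) (T : choiceType) (T' : eqType) (Sn : nat -> seq T) (D : T -> R).
Variables (L C : R) (codes : seq T').
Hypothesis qa : quasi_additive Sn D L C codes.
Variable Lam : R -> R.
Hypothesis hLam : forall (t : R) n,
  `|ln (partition_fun Sn D n t predT) - n%:R * Lam t| <= defect C codes t.

Local Notation Z := (partition_fun Sn D).
Local Notation ZT n t := (partition_fun Sn D n t predT).
Let Dopp (x : T) := - D x.
Let Lopp (t : R) := Lam (- t).

(** Reflection of [D] exchanges left and right, so one-sided statements are proved once. *)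
Lemma quasi_additive_opp : quasi_additive Sn Dopp L C codes.
Proof.
have [h1 h2 h3 h4 h5] := qa.
have opp (a b c : R) : `|- a - (- b + - c)| = `|a - (b + c)|.
  by rewrite -normrN; congr (`|_|); ring.
split => // [n x xn|n m|n m].
- by rewrite normrN; exact: h3.
- have [f [finj hf]] := h4 n m; exists f; split => // x /hf[f1 f2 f3].
  by split => //; rewrite opp.
- have [phi [kappa [inj hphi]]] := h5 n m; exists phi, kappa; split => // x y xn ym.
  by have [p1 p2 p3] := hphi x y xn ym; split => //; rewrite opp.
Qed.

Lemma partition_fun_opp n (t : R) (A : pred R) :
  partition_fun Sn Dopp n t A = Z n (- t) (fun r => A (- r)).
Proof. by apply: eq_bigr => x _; rewrite mulrN mulNr. Qed.

Lemma pressure_opp (t : R) n :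
  `|ln (partition_fun Sn Dopp n t predT) - n%:R * Lopp t| <= defect C codes t.
Proof.
have -> : partition_fun Sn Dopp n t predT = ZT n (- t) by exact: partition_fun_opp.
by have := hLam (- t) n; rewrite /defect normrN.
Qed.

Lemma left_slope_window (t s : R) : right_slope Lopp (- t) s ->
  exists2 p : R, 0 < p & forall eps : R, 0 < eps -> exists n0 : nat, forall n, (n0 <= n)%N ->
    p * ZT n t <= Z n t (window (- (n%:R * s)) (n%:R * eps)).
Proof.
move=> hs; have [p p0 hp] := right_slope_window quasi_additive_opp pressure_opp hs.
exists p => // eps eps0; have [n0 hn0] := hp eps eps0; exists n0 => n n0n.
have := hn0 n n0n; rewrite !partition_fun_opp opprK => h.
apply: le_trans h _; apply: partition_fun_mono => r; rewrite /window.
by rewrite -normrN opprD !opprK.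
Qed.

Lemma disjoint_partition_fun (J n : nat) (t : R) (W : 'I_J -> pred R) :
  (forall i j r, W i r -> W j r -> i = j) ->
  \sum_(j < J) Z n t (W j) <= ZT n t.
Proof.
move=> dis; rewrite /partition_fun.
under eq_bigr do rewrite big_mkcond.
rewrite exchange_big /=; apply: ler_sum => x _.
have e0 : 0 <= expR (t * D x) by exact: expR_ge0.
have [[j Wj]|h] := pselect (exists j, W j (D x)).
  rewrite (bigD1 j) //= Wj big1 ?addr0 // => i ij.
  by case: ifP => // Wi; move: ij; rewrite (dis i j _ Wi Wj) eqxx.
rewrite big1 // => j _; case: ifP => // Wj; case: h; by exists j.
Qed.

(* If the one-sided slopes [s1 < s2] differed, a fixed proportion of the tilted
   mass of every large sphere would sit near [s1] and near [s2]. Concatenating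
   spheres of radii [j q] and [(J + 1 - j) q] then puts a fixed proportion near
   each of [J] intermediate slopes, and [J] is arbitrary. *)
Lemma no_corner (t s1 s2 : R) :
  right_slope Lam t s2 -> right_slope Lopp (- t) (- s1) -> s2 <= s1.
Proof.
move=> h2 h1; rewrite leNgt; apply/negP => s12.
have [p2 p20 hp2] := right_slope_window qa hLam h2.
have [p1 p10 hp1] := left_slope_window h1.
have K1 := codes_ge1 qa.
set K : R := (size codes)%:R in K1.
(* Each window will carry at least the fraction 1 / c of the whole sum, where c involves neither J
   nor eps. *)
pose c := K * expR (`|t| * C) * expR (`|t| * C) / (p2 * p1).
have c0 : 0 < c.
  by rewrite divr_gt0 ?mulr_gt0 ?expR_gt0 //; apply: lt_le_trans K1.
pose J := (Num.truncn c).+1.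
have cJ : c < J%:R by exact: truncnS_gt.
pose Delta := s2 - s1.
have Delta0 : 0 < Delta by rewrite subr_gt0.
(* At the total radius (J + 1) q the slope error eps amounts to q Delta / 4. As C < q Delta / 4, the
   windows have half-width below q Delta / 2, while their centres are q Delta apart. *)
pose eps := Delta / (4 * J.+1%:R).
have eps0 : 0 < eps by rewrite divr_gt0 // mulr_gt0.
have Jeps : J.+1%:R * eps = Delta / 4 by rewrite /eps; field; rewrite ?pnatr_eq0; lra.
have [n2 hn2] := hp2 eps eps0; have [n1 hn1] := hp1 eps eps0.
have [[_ C0] _ _ _ _] := qa.
pose q := (n1 + n2 + (Num.truncn (4 * C / Delta)).+1)%N.
have qDelta : 4 * C < q%:R * Delta.
  rewrite -ltr_pdivrMr //; apply: lt_le_trans (truncnS_gt _) _.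
  by rewrite ler_nat leq_addl.
pose W (j : 'I_J) := window ((j.+1 * q)%:R * s2 + ((J - j) * q)%:R * s1)
  (q%:R * (Delta / 4) + C).
have dis i j r : W i r -> W j r -> i = j.
  move=> Wi Wj; apply/val_inj/eqP; rewrite eqn_leq; apply/andP.
  suff le (a b : 'I_J) : W a r -> W b r -> (a <= b)%N by split; exact: le.
  move=> {i j Wi Wj} Wa Wb; rewrite leqNgt; apply/negP => ba.
  move: Wa Wb; rewrite /W /window !ler_norml !natrM.
  rewrite !natrB ?(ltnW (ltn_ord _)) // -(natr1 a) -(natr1 b).
  have : (b : nat)%:R + 1 <= (a : nat)%:R :> R by rewrite natr1 ler_nat.
  move: (a : nat)%:R (b : nat)%:R (J%:R : R) => x y z xy.
  move=> /andP[ha _] /andP[_ hb].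
  have : q%:R * Delta * (y + 1) <= q%:R * Delta * x.
    by rewrite ler_wpM2l // mulr_ge0 // ltW.
  by move: ha hb qDelta; rewrite /Delta; lra.
have mass j : ZT (J.+1 * q) t <= c * Z (J.+1 * q) t (W j).
  have jq : (J.+1 * q = j.+1 * q + (J - j) * q)%N.
    by rewrite -mulnDl addSn subnKC // ltnW.
  have q1 : (n1 <= q)%N by rewrite /q -addnA leq_addr.
  have q2 : (n2 <= q)%N by rewrite /q -addnA addnCA leq_addr.
  have h2' := hn2 (j.+1 * q)%N (leq_trans q2 (leq_pmull _ (ltn0Sn _))).
  have Jj : (0 < J - j)%N by rewrite subn_gt0.
  have h1' := hn1 ((J - j) * q)%N (leq_trans q1 (leq_pmull _ Jj)).
  set n := (j.+1 * q)%N in jq h2' *; set m := ((J - j) * q)%N in jq h1' *.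
  have sup : Z n t (window (n%:R * s2) (n%:R * eps)) *
      Z m t (window (- (m%:R * - s1)) (m%:R * eps)) <=
      K * (expR (`|t| * C) * Z (n + m) t (W j)).
    apply: (partition_fun_supermult qa) => r1 r2 r.
    have e : n%:R * eps + m%:R * eps = q%:R * (Delta / 4).
      by rewrite -mulrDl -natrD -jq natrM mulrAC Jeps mulrC.
    rewrite /W /window -/n -/m !ler_norml => /andP[a1 a2] /andP[b1 b2] /andP[d1 d2].
    by apply/andP; split; lra.
  have sub := partition_fun_submult qa n m t.
  rewrite jq; rewrite /c mulrAC ler_pdivlMr ?mulr_gt0 //.
  apply: le_trans (_ : expR (`|t| * C) * ((p2 * ZT n t) * (p1 * ZT m t)) <= _).
    have := ler_wpM2r (ltW (mulr_gt0 p20 p10)) sub; move=> /le_trans; apply.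
    by rewrite le_eqVlt; apply/orP; left; apply/eqP; ring.
  have := ler_pM (mulr_ge0 (ltW p20) (ltW (partition_fun_gt0 qa n t)))
     (mulr_ge0 (ltW p10) (ltW (partition_fun_gt0 qa m t))) h2' h1'.
  move=> /le_trans /(_ sup) h; have := ler_wpM2l (expR_ge0 (`|t| * C)) h.
  by move=> /le_trans; apply; rewrite le_eqVlt; apply/orP; left; apply/eqP; ring.
have Z0 := partition_fun_gt0 qa (J.+1 * q) t.
have : \sum_(j < J) ZT (J.+1 * q) t <= c * ZT (J.+1 * q) t.
  apply: le_trans (ler_sum _ (fun j _ => mass j)) _; rewrite -mulr_sumr.
  by rewrite ler_wpM2l ?(ltW c0) //; exact: disjoint_partition_fun.
rewrite sumr_const card_ord -mulr_natl ler_pM2r // leNgt; apply/negP.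
by rewrite negbK.
Qed.

(** The derivative of [Lam] at t, as a global supporting line with first-order tangency on both
    sides. *)
Definition gradient (t s : R) := (forall u : R, Lam t + s * u <= Lam (t + u)) /\
  forall eta : R, 0 < eta -> exists2 u0 : R, 0 < u0 & forall u : R, `|u| <= u0 ->
    Lam (t + u) <= Lam t + s * u + eta * `|u|.

(** The absence of a corner gives one inequality between the one-sided slopes, midpoint convexity
    the other. *)
Lemma gradient_exists (t : R) : exists s, gradient t s.
Proof.
have [s2 h2] := right_slope_exists qa hLam t.
have [s1 h1] := right_slope_exists quasi_additive_opp pressure_opp (- t).
have hc : s2 <= - s1 by apply: no_corner h2 _; rewrite opprK.
have [h2a h2b] := h2; have [h1a h1b] := h1.
have LoppE u : Lopp (- t + u) = Lam (t - u).
  by rewrite /Lopp; congr Lam; ring.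
have Lopp0 : Lopp (- t) = Lam t by rewrite /Lopp opprK.
have hs : s1 = - s2.
  apply/eqP; rewrite eq_le; apply/andP; split; first lra.
  rewrite leNgt; apply/negP => s12.
  pose eta := (- s2 - s1) / 4.
  have eta0 : 0 < eta by rewrite divr_gt0 //; lra.
  have [u2 u20 hu2] := h2b eta eta0; have [u1 u10 hu1] := h1b eta eta0.
  pose u := Num.min u1 u2.
  have u0 : 0 < u by rewrite lt_min u10.
  have [uu1 uu2] : u <= u1 /\ u <= u2 by rewrite /u !ge_min !lexx orbT.
  have hu := hu2 u (ltW u0) uu2; have := hu1 u (ltW u0) uu1.
  rewrite LoppE Lopp0 => hu'.
  have half0 : (0 : R) <= 1 / 2 by lra.
  have half1 : (1 / 2 : R) <= 1 by lra.
  have := pressure_convex qa hLam (t + u) (t - u) half0 half1.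
  have -> : 1 / 2 * (t + u) + (1 - 1 / 2) * (t - u) = t by field.
  have : 0 < eta * u by exact: mulr_gt0.
  have : (- s2 - s1) * u = 4 * (eta * u) by rewrite /eta; field.
  by lra.
exists s2; split.
  move=> u; have [u0|u0] := leP 0 u; first exact: h2a.
  have := h1a (- u); rewrite LoppE Lopp0 opprK hs mulrNN; apply.
  by rewrite oppr_ge0 ltW.
move=> eta eta0.
have [u2 u20 hu2] := h2b eta eta0; have [u1 u10 hu1] := h1b eta eta0.
exists (Num.min u1 u2); first by rewrite lt_min u10.
move=> u; rewrite le_min => /andP[uu1 uu2].
have [u0|u0] := leP 0 u.
  by rewrite ger0_norm // in uu2 *; have := hu2 u u0 uu2; lra.
rewrite ltr0_norm // in uu1 *.
have := hu1 (- u); rewrite LoppE Lopp0 opprK hs => /(_ _ uu1).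
by rewrite oppr_ge0 => /(_ (ltW u0)); lra.
Qed.

Lemma partition_fun_norm n (t u : R) : `|u| <= 1 ->
  ZT n (t + u) <= expR (n%:R * (Lam (t + u) - Lam t) +
     2 * ((`|t| + 1) * C + ln (size codes)%:R)) * ZT n t.
Proof.
move=> u1; set c := (`|t| + 1) * C + _.
have [[_ C0] _ _ _ _] := qa.
have c1 (v : R) : `|v| <= 1 -> defect C codes (t + v) <= c.
  move=> v1; rewrite lerD2r ler_wpM2r //.
  by apply: le_trans (ler_normD _ _) _; rewrite lerD2l.
have /andP[_ h1] := partition_fun_bounds qa hLam n (t + u).
have /andP[h2 _] := partition_fun_bounds qa hLam n t.
have h3 : defect C codes t <= c by rewrite -[t]addr0 c1 // normr0.
have h4 := c1 u u1.
apply: le_trans h1 _; apply: le_trans (ler_wpM2l (expR_ge0 _) h2).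
by rewrite -expRD ler_expR; lra.
Qed.

(** Chernoff's inequality with a fixed tilt u to either side gains u n eps in the exponent; tangency
    up to eps / 2 gives back at most half of it, so both tails decay exponentially. *)
Lemma concentration (t s : R) : gradient t s -> forall eps p : R, 0 < eps -> 0 < p ->
  exists n0 : nat, forall n, (n0 <= n)%N ->
    Z n t (predC (window (n%:R * s) (n%:R * eps))) <= p * ZT n t.
Proof.
move=> [_ hg] eps p eps0 p0.
have e20 : 0 < eps / 2 by rewrite divr_gt0.
have [u0 u00 hu0] := hg _ e20.
pose u := Num.min u0 1.
have u_gt0 : 0 < u by rewrite lt_min u00 ltr01.
have [uu0 u1] : u <= u0 /\ u <= 1 by rewrite /u !ge_min !lexx orbT.
pose c := 2 * ((`|t| + 1) * C + ln (size codes)%:R).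
pose x := u * (eps / 2).
have x0 : 0 < x by exact: mulr_gt0.
exists (Num.truncn (2 * expR c / (x * p))).+1 => n n0n.
have hn : 2 * expR c < p * (n%:R * x).
  have : 2 * expR c / (x * p) < n%:R.
    by apply: lt_le_trans (truncnS_gt _) _; rewrite ler_nat.
  by rewrite ltr_pdivrMr ?mulr_gt0 //; lra.
have Z0 := partition_fun_gt0 qa n t.
have tail (v a : R) : `|v| = u -> v * a = u * (n%:R * eps) + v * (n%:R * s) ->
    expR (- (v * a)) * ZT n (t + v) <= expR (c - n%:R * x) * ZT n t.
  move=> vu va; have v1 : `|v| <= 1 by rewrite vu.
  apply: le_trans (ler_wpM2l (expR_ge0 _) (partition_fun_norm n t v1)) _.
  rewrite mulrA ler_pM2r // -expRD ler_expR -/c.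
  have v0 : `|v| <= u0 by rewrite vu.
  have : n%:R * Lam (t + v) <= n%:R * (Lam t + s * v + eps / 2 * u).
    by rewrite -{1}vu ler_wpM2l // hu0.
  by rewrite va /x; lra.
have half : 2 * expR (c - n%:R * x) <= p.
  rewrite expRD expRN mulrA ler_pdivrMr ?expR_gt0 //.
  apply: le_trans (ltW hn) _; rewrite ler_pM2l //.
  by have := expR_ge1Dx (n%:R * x); lra.
have t1 : Z n t (fun r => n%:R * s + n%:R * eps <= r) <= expR (c - n%:R * x) * ZT n t.
  apply: le_trans (chernoff_ge _ _ _ _ _ (ltW u_gt0)) _.
  by apply: tail; [rewrite gtr0_norm|ring].
have t2 : Z n t (fun r => r <= n%:R * s - n%:R * eps) <= expR (c - n%:R * x) * ZT n t.
  apply: le_trans (chernoff_le _ _ _ _ _ (ltW u_gt0)) _.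
  rewrite -[u * (_ - _)]opprK -mulNr; apply: tail; [by rewrite normrN gtr0_norm|ring].
apply: le_trans (_ : Z n t (fun r => n%:R * s + n%:R * eps <= r) +
    Z n t (fun r => r <= n%:R * s - n%:R * eps) <= _).
  rewrite /partition_fun big_mkcond [X in _ <= X + _]big_mkcond [X in _ <= _ + X]big_mkcond.
  rewrite -big_split /=; apply: ler_sum => y _; rewrite /window.
  have e0 := expR_ge0 (t * D y); move: (D y) (expR _) e0 => r e e0.
  rewrite ler_norml negb_and -!ltNge.
  have -> : (n%:R * s + n%:R * eps <= r) = (n%:R * eps <= r - n%:R * s) by rewrite lerBrDl.
  have -> : (r <= n%:R * s - n%:R * eps) = (r - n%:R * s <= - (n%:R * eps)) by rewrite lerBlDl.
  move: (r - _) (n%:R * eps) => a b.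
  by case: ltP => [/ltW ->|_]; case: ltP => [/ltW ->|_] /=; do ?case: ifP => _;
    rewrite ?addr0 ?add0r ?lerDl ?addr_ge0.
apply: le_trans (lerD t1 t2) _; rewrite -mulrDl ler_pM2r //.
by apply: le_trans half; lra.
Qed.

(** Cramer's change of measure: the sum tilted by t concentrates near n s, and removing the tilt
    inside the window multiplies each weight by about exp(- n t s). *)
Lemma window_lower_bound (t s : R) : gradient t s -> forall eps eps' : R, 0 < eps -> 0 < eps' ->
  exists n0 : nat, forall n, (n0 <= n)%N ->
    expR (- (n%:R * (t * s - Lam t + Lam 0 + eps'))) * ZT n 0
      <= Z n 0 (window (n%:R * s) (n%:R * eps)).
Proof.
move=> hg eps eps' eps0 eps'0.
(* The narrower window keeps the variation of the tilt below n eps' / 2; the other half of eps'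
   absorbs the constants for large n. *)
pose e := Num.min eps (eps' / (2 * (`|t| + 1))).
have t1 : 0 < `|t| + 1 by rewrite ltr_wpDl.
have e0 : 0 < e by rewrite lt_min eps0 divr_gt0 // mulr_gt0.
have ee : e <= eps by rewrite /e ge_min lexx.
have te : `|t| * e <= eps' / 2.
  have h : e <= eps' / (2 * (`|t| + 1)) by rewrite /e ge_min lexx orbT.
  rewrite ler_pdivlMr ?mulr_gt0 // in h.
  by have := normr_ge0 t; have := mulr_ge0 (normr_ge0 t) (ltW e0); lra.
have half0 : (0 : R) < 1 / 2 by lra.
have [n0 hn0] := concentration hg e0 half0.
pose c := defect C codes t + defect C codes 0.
exists (n0 + (Num.truncn (2 * (2 * expR c) / eps')).+1)%N => n n0n.
have nn0 : (n0 <= n)%N by apply: leq_trans n0n; exact: leq_addr.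
have hn : 2 * expR c <= expR (n%:R * (eps' / 2)).
  apply: le_trans (expR_ge1Dx _).
  have : 2 * (2 * expR c) / eps' < n%:R.
    apply: lt_le_trans (truncnS_gt _) _; rewrite ler_nat.
    by apply: leq_trans n0n; exact: leq_addl.
  by rewrite ltr_pdivrMr //; lra.
have win : ZT n t <= 2 * Z n t (window (n%:R * s) (n%:R * e)).
  have := hn0 n nn0.
  have -> : ZT n t = Z n t (window (n%:R * s) (n%:R * e)) +
      Z n t (predC (window (n%:R * s) (n%:R * e))).
    by rewrite /partition_fun (bigID (fun x => window (n%:R * s) (n%:R * e) (D x))).
  by lra.
have tilt : Z n t (window (n%:R * s) (n%:R * e)) <=
    expR (n%:R * (t * s) + n%:R * (eps' / 2)) * Z n 0 (window (n%:R * s) (n%:R * eps)).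
  apply: ler_partition_fun => x _ wx; split.
    by apply: le_trans wx _; rewrite ler_wpM2l.
  rewrite mul0r expR0 mulr1 ler_expR.
  have -> : t * D x = n%:R * (t * s) + t * (D x - n%:R * s) by ring.
  rewrite lerD2l; apply: le_trans (ler_norm _) _; rewrite normrM.
  apply: le_trans (ler_wpM2l (normr_ge0 _) wx) _.
  by rewrite mulrCA ler_wpM2l.
have /andP[h1 _] := partition_fun_bounds qa hLam n t.
have /andP[_ h2] := partition_fun_bounds qa hLam n 0.
set Wn := Z n 0 _ in tilt *.
apply: le_trans (ler_wpM2l (expR_ge0 _) h2) _; rewrite -expRD.
have h3 : expR (n%:R * Lam t - defect C codes t) <=
    2 * (expR (n%:R * (t * s) + n%:R * (eps' / 2)) * Wn) by lra.
rewrite -(ler_pM2l (expR_gt0 (n%:R * (t * s) + n%:R * (eps' / 2)))).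
rewrite -(ler_pM2l (ltr0Sn R 1)); apply: le_trans h3.
rewrite -expRD; apply: le_trans (_ : 2 * expR c *
  expR (n%:R * Lam t - defect C codes t - n%:R * (eps' / 2)) <= _).
  rewrite -mulrA -expRD ler_pM2l // ler_expR /c; lra.
apply: le_trans (ler_wpM2r (expR_ge0 _) hn) _.
by rewrite -expRD ler_expR; lra.
Qed.

End Differentiability.

(** * Large deviations *)

Lemma le_expR_eventually (R : realType) (K x : R) : 0 < x ->
  exists n0 : nat, forall n, (n0 <= n)%N -> K <= expR (n%:R * x).
Proof.
move=> x0; exists (Num.truncn (K / x)).+1 => n n0n.
have : K / x < n%:R by apply: lt_le_trans (truncnS_gt _) _; rewrite ler_nat.
by rewrite ltr_pdivrMr //; have := expR_ge1Dx (n%:R * x); lra.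
Qed.

Lemma closed_min_right (R : realType) (V : set R) (a : R) : closed V ->
  (exists2 v, V v & a <= v) ->
  exists v, [/\ V v, a <= v & forall w, V w -> a <= w -> v <= w].
Proof.
move=> cV [v Vv av]; pose A := [set w | V w /\ a <= w].
have A0 : A !=set0 by exists v.
have lbA : has_lbound A by exists a => w [].
have ainf : a <= inf A by apply: lb_le_inf => // w [].
exists (inf A); split => //; last by move=> w Vw aw; apply: ge_inf.
apply: contrapT => nV.
have /nbhs_ballP[e /= e0 he] : nbhs (inf A) (~` V).
  by apply: open_nbhs_nbhs; split => //; exact: closed_openC.
have [w [Vw aw] we] := inf_adherent e0 (conj A0 lbA).
have infw : inf A <= w by apply: ge_inf.
apply: (he w) Vw; rewrite -ball_normE /= ltr_norml; lra.
Qed.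

Section LargeDeviations.
Variables (R : realType) (T : choiceType) (T' : eqType) (Sn : nat -> seq T).
Variables (L C : R) (codes : seq T').

(** [V] may be unbounded, but to the right of tau a single Chernoff bound at its least point
    controls all of it. The strict margin rho < rho' is there to absorb constants. [D] and [Lam] are
    arguments so that the reflected data give the left side. *)
Lemma upper_bound_right (D : T -> R) (Lam : R -> R) (V : set R) (tau rho : R) :
  quasi_additive Sn D L C codes ->
  (forall t n, `|ln (partition_fun Sn D n t predT) - n%:R * Lam t| <= defect C codes t) ->
  closed V -> 0 <= rho -> (forall t, tau * t <= Lam t - Lam 0) ->
  (forall v, V v -> exists t, rho < t * v - Lam t + Lam 0) ->
  exists c rho' : R, rho < rho' /\ forall n, (0 < n)%N ->
    partition_fun Sn D n 0 (fun r => `[< V (r / n%:R) >] && (tau <= r / n%:R)) <=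
      expR (c - n%:R * rho') * partition_fun Sn D n 0 predT.
Proof.
move=> qa hLam cV rho0 htau hV.
have [[v [Vv tv vmin]]|hn] := pselect (exists v, [/\ V v, tau <= v &
    forall w, V w -> tau <= w -> v <= w]); last first.
  exists 0, (rho + 1); split; first lra.
  move=> n n0; rewrite /partition_fun [leLHS]big1 ?mulr_ge0 ?expR_ge0 //.
    by apply: sumr_ge0 => x _; exact: expR_ge0.
  move=> x /andP[/asboolP Vx tx]; case: hn; apply: closed_min_right => //.
  by exists (D x / n%:R).
have [t ht] := hV v Vv.
(* v lies to the right of tau, and tau is a subgradient at 0, so a tilt t <= 0 cannot give a
   positive exponent. *)
have t0 : 0 < t.
  rewrite ltNge; apply/negP => t0; have := htau t.
  by have := ler_wnM2l t0 tv; lra.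
exists (defect C codes t + defect C codes 0), (t * v - Lam t + Lam 0); split => // n n0.
have n0' : 0 < n%:R :> R by rewrite ltr0n.
apply: le_trans (_ : partition_fun Sn D n 0 (fun r => n%:R * v <= r) <= _).
  apply: partition_fun_mono => r /andP[/asboolP Vr tr].
  by rewrite mulrC -ler_pdivlMr // vmin.
apply: le_trans (chernoff_ge _ _ _ _ _ (ltW t0)) _; rewrite add0r.
have /andP[_ h1] := partition_fun_bounds qa hLam n t.
have /andP[h2 _] := partition_fun_bounds qa hLam n 0.
apply: le_trans (ler_wpM2l (expR_ge0 _) h1) _.
apply: le_trans (ler_wpM2l (expR_ge0 _) h2); rewrite -!expRD ler_expR.
lra.
Qed.

Variables (D : T -> R) (Lam : R -> R).
Hypothesis qa : quasi_additive Sn D L C codes.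
Hypothesis hLam : forall t n,
  `|ln (partition_fun Sn D n t predT) - n%:R * Lam t| <= defect C codes t.

Local Notation Z := (partition_fun Sn D).
Local Notation ZT n t := (partition_fun Sn D n t predT).

Lemma ldp_upper (V : set R) (rho : R) : closed V -> 0 <= rho ->
  (forall v, V v -> exists t, rho < t * v - Lam t + Lam 0) ->
  exists n0 : nat, forall n, (n0 <= n)%N ->
    Z n 0 (fun r => `[< V (r / n%:R) >]) <= expR (- (n%:R * rho)) * ZT n 0.
Proof.
move=> cV rho0 hV.
have [tau [htau _]] := gradient_exists qa hLam 0.
have htau1 t : tau * t <= Lam t - Lam 0.
  by have := htau t; rewrite add0r; lra.
have [c1 [r1 [rho1 h1]]] := upper_bound_right qa hLam cV rho0 htau1 hV.
have cV' : closed [set - v | v in V].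
  have -> : [set - v | v in V] = (fun x : R => - x) @^-1` V.
    apply/seteqP; split => [_ [v Vv <-] /=|v /= Vv]; first by rewrite opprK.
    by exists (- v) => //; rewrite opprK.
  by apply: closed_comp => // x _; exact: opp_continuous.
have htau2 t : - tau * t <= Lam (- t) - Lam (- 0).
  by have := htau1 (- t); rewrite oppr0; lra.
have hV' v : [set - v | v in V] v -> exists t, rho < t * v - Lam (- t) + Lam (- 0).
  by move=> [w /hV[t ht] <-]; exists (- t); rewrite opprK oppr0 mulrNN; exact: ht.
have [c2 [r2 [rho2 h2]]] := upper_bound_right (quasi_additive_opp qa) (pressure_opp hLam)
  cV' rho0 htau2 hV'.
have d1 : 0 < r1 - rho by rewrite subr_gt0.
have d2 : 0 < r2 - rho by rewrite subr_gt0.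
(* The margins above rho absorb the constants and the factor 2 that comes from adding both sides. *)
have [n1 hn1] := le_expR_eventually (2 * expR c1) d1.
have [n2 hn2] := le_expR_eventually (2 * expR c2) d2.
exists (n1 + n2).+1 => n n0n.
have n0 : (0 < n)%N by apply: leq_trans n0n.
have n10 : (n1 <= n)%N by apply: leq_trans n0n; rewrite leqW // leq_addr.
have n20 : (n2 <= n)%N by apply: leq_trans n0n; rewrite leqW // leq_addl.
have Z0 := partition_fun_gt0 qa n 0.
have half c r : 2 * expR c <= expR (n%:R * (r - rho)) ->
    expR (c - n%:R * r) <= expR (- (n%:R * rho)) / 2.
  move=> h; rewrite ler_pdivlMr // expRD mulrC mulrA.
  apply: le_trans (ler_wpM2r (expR_ge0 _) h) _; rewrite -expRD ler_expR; lra.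
apply: le_trans (_ : Z n 0 (fun r => `[< V (r / n%:R) >] && (tau <= r / n%:R)) +
   partition_fun Sn (fun x => - D x) n 0
     (fun r => `[< [set - v | v in V] (r / n%:R) >] && (- tau <= r / n%:R)) <= _).
  rewrite (partition_fun_opp Sn D) oppr0 /partition_fun.
  rewrite [leLHS]big_mkcond [X in _ <= X + _]big_mkcond [X in _ <= _ + X]big_mkcond.
  rewrite -big_split /=; apply: ler_sum => x _.
  have e0 := expR_ge0 (0 * D x); rewrite mulNr lerN2.
  case: asboolP => /= Vx; last by rewrite addr_ge0 //; case: ifP.
  have -> : `[< exists2 y : R, V y & - y = - (D x / n%:R) >].
    by apply/asboolP; exists (D x / n%:R).
  by case: (leP tau) => /= h; rewrite ?(ltW h) ?add0r // lerDl; case: ifP.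
apply: le_trans (lerD (h1 n n0) (h2 n n0)) _.
rewrite (partition_fun_opp Sn D) oppr0 -mulrDl ler_pM2r //.
by have := half _ _ (hn1 n n10); have := half _ _ (hn2 n n20); lra.
Qed.

(** Uniqueness of derivatives: a linear form bounded above by o(|u|) vanishes, as u takes both
    signs. *)
Lemma linear_le_small (x : R) : (forall eta, 0 < eta -> exists2 u0, 0 < u0 &
  forall u, `|u| <= u0 -> u * x <= eta * `|u|) -> x = 0.
Proof.
move=> h; apply/eqP; rewrite -normr_eq0; apply/eqP/le_anti; rewrite normr_ge0 andbT.
apply/ler_addgt0Pr => eta eta0; rewrite add0r; have [u0 u00 hu] := h eta eta0.
have h1 := hu u0; rewrite gtr0_norm // lexx in h1.
have h2 := hu (- u0); rewrite normrN gtr0_norm // lexx in h2.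
rewrite ler_norml -(ler_pM2l u00) -(ler_pM2l u00 x eta).
by apply/andP; split; [have := h2 isT|have := h1 isT]; lra.
Qed.

Lemma pressure_continuous : continuous Lam.
Proof.
move=> t; apply/cvgrPdist_le => eps eps0.
have L1 : 0 < L + 1 by have [[? _] _ _ _ _] := qa; lra.
near=> u.
have h : `|u - t| <= eps / (L + 1).
  by near: u; apply: cvgr_distC_le; [exact: cvg_id|rewrite divr_gt0].
rewrite ler_pdivlMr // in h.
have h1 := pressure_lipschitz qa hLam t u; have h2 := pressure_lipschitz qa hLam u t.
rewrite distrC in h2.
have := normr_ge0 (u - t); rewrite ler_norml; lra.
Unshelve. all: by end_near.
Qed.

(* The slope [s] need not be attained by the derivative of the pressure; the
   penalised function [t s - Lam t - k t^2 / 2] attains its maximum at a [t]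
   with [Lam' t = s - k t], a slope close to [s] whose rate is not larger. *)
Lemma nearby_gradient (s r k : R) : (forall t, t * s - Lam t + Lam 0 <= r) -> 0 < k ->
  exists t s', [/\ gradient Lam t s', (s - s') ^+ 2 <= 2 * k * r &
    t * s' - Lam t + Lam 0 <= r].
Proof.
move=> hr k0.
have r0 : 0 <= r by have := hr 0; rewrite mul0r; lra.
pose h t := t * s - Lam t - k / 2 * t ^+ 2.
have ch : continuous h.
  move=> t; apply: cvgB; last by apply: cvgMr; apply: exprn_continuous.
  apply: cvgB; last exact: pressure_continuous.
  by apply: cvgMl; exact: cvg_id.
(* Beyond B the penalty k u^2 / 2 is at least r, so the penalised function does not exceed its value
   at 0, and a maximum on [-B, B] is global. *)
pose B := 2 * r / k + 1.
have B1 : 1 <= B by rewrite /B lerDr divr_ge0 ?mulr_ge0 // ltW.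
have [||t tB tmax] := @EVT_max R h (- B) B.
- lra.
- by apply: continuous_subspaceT => x; exact: ch.
have tmax' u : h u <= h t.
  have [uB|uB] := boolP (u \in `[- B, B]); first exact: tmax.
  have h0 : h 0 <= h t by apply: tmax; rewrite in_itv /=; lra.
  apply: le_trans h0; rewrite /h mul0r sub0r expr0n mulr0 subr0.
  have Bu : B < `|u|.
    by rewrite ltNge ler_norml; move: uB; rewrite in_itv.
  have : 2 * r <= k * u ^+ 2.
    have u2 : u ^+ 2 = `|u| ^+ 2 by rewrite real_normK ?num_real.
    have : 2 * r / k <= u ^+ 2.
      apply: le_trans (_ : B <= _); first by rewrite /B lerDl.
      by rewrite u2; apply: le_trans (ltW Bu) _; rewrite expr2 ler_peMl //; lra.
    by rewrite ler_pdivrMr // (mulrC k).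
  by have := hr u; lra.
have [s' hs'] := gradient_exists qa hLam t.
have s'E : s - k * t - s' = 0.
  apply: linear_le_small => eta eta0.
  have e2 : 0 < eta / 2 by rewrite divr_gt0.
  have [_ /(_ _ e2)[u0 u00 hu0]] := hs'.
  exists (Num.min u0 (eta / k)); first by rewrite lt_min u00 divr_gt0.
  move=> u; rewrite le_min => /andP[/hu0 h1]; rewrite ler_pdivlMr // => h2.
  have := tmax' (t + u); rewrite /h sqrrD.
  have : k * u ^+ 2 <= eta * `|u|.
    have -> : u ^+ 2 = `|u| ^+ 2 by rewrite real_normK ?num_real.
    by rewrite expr2 mulrA ler_wpM2r // mulrC.
  by lra.
exists t, s'; split => //.
- have -> : s - s' = k * t by lra.
  have := tmax' 0; rewrite /h mul0r sub0r expr0n mulr0 subr0.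
  have := hr t => h1 h2.
  have : k / 2 * t ^+ 2 <= r by lra.
  rewrite exprMn => h3; have : (2 * k) * (k / 2 * t ^+ 2) <= (2 * k) * r.
    by rewrite ler_wpM2l // mulr_ge0 // ltW.
  by rewrite expr2; lra.
- have -> : s' = s - k * t by lra.
  have : 0 <= k * t ^+ 2 by rewrite mulr_ge0 ?sqr_ge0 // ltW.
  by have := hr t; rewrite mulrBr; lra.
Qed.

Lemma ldp_lower (U : set R) (s r rho : R) : open U -> U s ->
  (forall t, t * s - Lam t + Lam 0 <= r) -> r < rho ->
  exists n0 : nat, forall n, (n0 <= n)%N ->
    expR (- (n%:R * rho)) * ZT n 0 <= Z n 0 (fun v => `[< U (v / n%:R) >]).
Proof.
move=> oU Us hr rrho.
have r0 : 0 <= r by have := hr 0; rewrite mul0r; lra.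
have /nbhs_ballP[e /= e0 he] : nbhs s U by apply: open_nbhs_nbhs.
(* This makes 2 k r <= (e / 2)^2, so that s' is within e / 2 of s and a window of half-width e / 4
   around s' stays in [U]. *)
pose k := (e / 2) ^+ 2 / (2 * (r + 1)).
have k0 : 0 < k by rewrite divr_gt0 ?exprn_gt0 ?mulr_gt0 ?divr_gt0 //; lra.
have [t [s' [hs' ss' hr']]] := nearby_gradient hr k0.
have {}ss' : `|s - s'| <= e / 2.
  have h2 : `|s - s'| ^+ 2 <= (e / 2) ^+ 2.
    rewrite real_normK ?num_real //; apply: le_trans ss' _.
    have r1 : 0 < 2 * (r + 1) by lra.
    have -> : 2 * k * r = (e / 2) ^+ 2 * (2 * r) / (2 * (r + 1)) by rewrite /k; ring.
    have := sqr_ge0 (e / 2); rewrite ler_pdivrMr // => h.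
    by apply: ler_wpM2l => //; lra.
  by rewrite leNgt; apply/negP => h4; nra.
have e4 : 0 < e / 4 by rewrite divr_gt0.
have drho : 0 < rho - r by rewrite subr_gt0.
have [n0 hn0] := window_lower_bound qa hLam hs' e4 drho.
exists n0.+1 => n n0n; have n00 : 0 < n%:R :> R.
  by rewrite ltr0n; apply: leq_trans n0n.
apply: le_trans (_ : expR (- (n%:R * (t * s' - Lam t + Lam 0 + (rho - r)))) * ZT n 0 <= _).
  rewrite ler_wpM2r ?partition_fun_ge0 // ler_expR lerN2 ler_wpM2l //; lra.
apply: le_trans (hn0 n (ltnW n0n)) _; apply: partition_fun_mono => v; rewrite /window => hv.
apply/asboolP; apply: he; rewrite -ball_normE /=.
have : `|v / n%:R - s'| <= e / 4.
  rewrite -(ler_pM2l n00) -{1}(gtr0_norm n00) -normrM mulrBr mulrCA divff ?gt_eqF //.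
  by rewrite mulr1.
by move: ss'; rewrite !ler_norml ltr_norml; lra.
Qed.

(** By convexity the difference quotients from 0 increase with t; [L] bounds them, and their
    supremum is the slope at infinity. *)
Lemma asymptotic_slope : exists alpha : R,
  [/\ forall t, 0 <= t -> Lam t - Lam 0 <= alpha * t,
      forall s, s < alpha -> exists2 t1, 0 < t1 & forall t, t1 <= t -> s * t <= Lam t - Lam 0 &
      Lam t / t @[t --> +oo] --> alpha].
Proof.
pose E := [set (Lam t - Lam 0) / t | t in [set t : R | 0 < t]].
have E0 : E !=set0 by exists ((Lam 1 - Lam 0) / 1); exists 1 => /=.
have Eub : has_ubound E.
  exists L => _ [t /= t0 <-]; rewrite ler_pdivrMr //.
  by have := pressure_lipschitz qa hLam 0 t; rewrite subr0 gtr0_norm //; lra.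
have upper t : 0 <= t -> Lam t - Lam 0 <= sup E * t.
  rewrite le_eqVlt => /orP[/eqP<-|t0]; first by rewrite subrr mulr0.
  by rewrite -ler_pdivrMr //; apply: ub_le_sup => //; exists t.
have lower s : s < sup E -> exists2 t1, 0 < t1 & forall t, t1 <= t -> s * t <= Lam t - Lam 0.
  move=> sE; have e0 : 0 < sup E - s by rewrite subr_gt0.
  have [_ [t1 /= t10 <-]] := sup_adherent e0 (conj E0 Eub).
  rewrite subKr ltr_pdivlMr // => h; exists t1 => // t t1t.
  have t0 : 0 < t by apply: lt_le_trans t1t.
  have l0 : 0 <= t1 / t by rewrite divr_ge0 // ltW.
  have l1 : t1 / t <= 1 by rewrite ler_pdivrMr // mul1r.
  have := pressure_convex qa hLam t 0 l0 l1.
  rewrite mulr0 addr0 divfK ?gt_eqF // => hc.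
  have : s * t1 <= (t1 / t) * (Lam t - Lam 0) by lra.
  by rewrite mulrAC ler_pdivlMr // => h5; rewrite -(ler_pM2l t10); lra.
exists (sup E); split => //; apply/cvgrPdist_le => eps eps0.
have e2 : 0 < eps / 2 by rewrite divr_gt0.
have [t1 t10 ht1] := lower (sup E - eps / 2) ltac:(lra).
near=> t.
have t0 : 0 < t by near: t; exact: nbhs_pinfty_gt.
have tt1 : t1 <= t by near: t; apply: nbhs_pinfty_ge; exact: num_real.
have t2 : 2 * `|Lam 0| / eps <= t by near: t; apply: nbhs_pinfty_ge; exact: num_real.
rewrite ler_pdivrMr // in t2.
have h1 := upper t (ltW t0); have h2 := ht1 t tt1.
have -> : sup E - Lam t / t = (sup E * t - Lam t) / t by rewrite mulrBl mulfK ?gt_eqF.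
rewrite normrM normfV (gtr0_norm t0) ler_pdivrMr //.
have h3 := ler_norm (Lam 0); have h4 := ler_norm (- Lam 0); rewrite normrN in h4.
by rewrite ler_norml; lra.
Unshelve. all: by end_near.
Qed.

End LargeDeviations.

(** * The Manhattan curve and the rate function *)

Section Assembly.
Variables (R : realType) (G : groupType) (S : set G) (d : G -> G -> R).
Hypothesis hS : finite_symmetric_generators S.
Hypothesis hd : D_metric d.

Local Notation len := (word_length S).
Local Notation D := (d 1%g).
Local Notation Sn := (fun n => enum_fset (wsphere S n)).
Local Notation Z := (partition_fun Sn D).
Local Notation ZT n t := (partition_fun Sn D n t predT).

Lemma sphere_quasi_additive : ~ amenable R G ->
  (exists (L C : R) (codes : seq (G * G * G)), quasi_additive Sn D L C codes) /\
  exists2 eps : R, 0 < eps & forall n t,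
    (1 + t%:R * eps) * #|` wball S n|%:R <= #|` wball S (n + t)|%:R.
Proof.
move=> namen; have growth := nonamenable_growth hS namen.
have linear := wball_growth_linear growth; split => //.
have [L [C [L1 C0 LC]]] := word_metric_comparison hS hd.
have [_ _ [delta delta0 hyp] _] := hd.
have [C1 C10 hsplit] := sphere_split hS hd delta0 hyp L1 C0 LC.
have [C2 [codes [C20 hconcat]]] := sphere_concat hS hd delta0 hyp L1 C0 LC growth.
exists L, (C1 + C2), codes; split.
- by split; lra.
- move=> n; split; first exact: fset_uniq.
  case: n => [|n].
    have : 1%g \in wsphere S 0 by rewrite (in_wsphere hS) (word_length1 hS).
    rewrite -[_ \in _]/(1%g \in enum_fset (wsphere S 0)).
    by case: (enum_fset (wsphere S 0)) => // /[!in_nil].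
  (* An empty sphere would make two successive balls equal, contrary to their growth. *)
  apply/negP => /eqP empty.
  have [eps eps0 /(_ n)] := growth; apply/negP; rewrite -ltNge.
  have -> : wball S n.+1 = wball S n.
    apply/fsetP => x; rewrite !(in_wball hS) leq_eqVlt ltnS.
    have : x \notin wsphere S n.+1 by rewrite -[_ \in _]/(x \in enum_fset (wsphere S n.+1)) empty.
    by rewrite (in_wsphere hS) => /negbTE ->.
  by rewrite ltr_pMl ?ltr0n ?(card_wball_gt0 hS) // ltrDl.
- move=> n x; rewrite (in_wsphere hS) => /eqP <-; have [h _] := LC 1%g x.
  rewrite ger0_norm; first by rewrite invg1 mul1g in h.
  by have [[d0 _ _ _] _ _ _] := hd.
- move=> n m; have [f [finj hf]] := hsplit n m; exists f; split => // x /hf[h1 h2 h3].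
  by split => //; apply: le_trans h3 _; rewrite lerDl.
- move=> n m; have [phi [kappa [inj hphi]]] := hconcat n m; exists phi, kappa; split => //.
  move=> x y xn ym; have [h1 h2 h3] := hphi x y xn ym.
  by split => //; apply: le_trans h3 _; rewrite lerDr.
Qed.

Lemma sum_wball (f : G -> R) N :
  \sum_(x <- wball S N) f x = \sum_(n < N.+1) \sum_(x <- wsphere S n) f x.
Proof.
have step (n : 'I_N.+1) : \sum_(x <- wsphere S n) f x =
    \sum_(x <- wball S N) if len x == n then f x else 0.
  rewrite -big_mkcond -[RHS]big_filter; apply: perm_big; apply: uniq_perm.
  - exact: fset_uniq.
  - by apply: filter_uniq; exact: fset_uniq.
  move=> x; rewrite mem_filter (in_wsphere hS) (in_wball hS).
  by case: eqP => //= ->; rewrite -ltnS ltn_ord.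
under [RHS]eq_bigr do rewrite step.
rewrite exchange_big /=; apply: eq_big_seq => x; rewrite (in_wball hS) -ltnS => xN.
rewrite (bigD1 (Ordinal xN)) //= eqxx big1 ?addr0 // => i ix.
by case: eqP => // xi; case/eqP: ix; apply/val_inj.
Qed.

Lemma sphere_sum_manhattan (a b : R) n :
  \sum_(x <- wsphere S n) expR (- a * D x - b * (len x)%:R) =
  expR (- (n%:R * b)) * ZT n (- a).
Proof.
rewrite mulr_sumr; apply: eq_big_seq => x; rewrite (in_wsphere hS) => /eqP ->.
by rewrite -expRD; congr expR; ring.
Qed.

Section WithPressure.
Variables (L C : R) (codes : seq (G * G * G)) (Lam : R -> R).
Hypothesis qa : quasi_additive Sn D L C codes.
Hypothesis hLam : forall t n, `|ln (ZT n t) - n%:R * Lam t| <= defect C codes t.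

(** The spheres are dominated by a geometric series of ratio exp(Lam(-a) - b), and every finite
    partial sum sits inside a ball. *)
Lemma manhattan_summable (a b : R) : Lam (- a) < b ->
  (\esum_(x in [set: G]) (expR (- a * D x - b * (len x)%:R))%:E < +oo)%E.
Proof.
move=> ab; set f := fun x => expR (- a * D x - b * (len x)%:R).
pose r := expR (Lam (- a) - b); have r0 : 0 < r by exact: expR_gt0.
have r1 : r < 1 by rewrite -expR0 ltr_expR subr_lt0.
pose c := expR (defect C codes (- a)).
apply: le_lt_trans (_ : (_ <= (c / (1 - r))%:E)%E) (ltry _).
apply: ge_ereal_sup => _ [A [fA _] <-].
rewrite fsbig_finite // sumEFin lee_fin.
pose N := \max_(x <- fset_set A) len x.
apply: le_trans (_ : \sum_(x <- wball S N) f x <= _).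
  apply: (@ler_sum_inj _ _ _ _ _ id) => //.
  - by move=> x xA; rewrite (in_wball hS); exact: leq_bigmax_seq.
  - by move=> x; exact: expR_ge0.
rewrite sum_wball ler_pdivlMr ?subr_gt0 //.
have hn n : \sum_(x <- wsphere S n) f x <= c * r ^+ n.
  rewrite sphere_sum_manhattan; have /andP[_ h] := partition_fun_bounds qa hLam n (- a).
  apply: le_trans (ler_wpM2l (expR_ge0 _) h) _.
  rewrite /c /r -expRM_natl -!expRD ler_expR; lra.
apply: le_trans (_ : (\sum_(n < N.+1) c * r ^+ n) * (1 - r) <= _).
  by apply: ler_wpM2r; [lra|apply: ler_sum => n _; exact: hn].
rewrite -mulr_sumr -mulrA -[leRHS]mulr1 ler_wpM2l ?expR_ge0 //.
rewrite mulrC -opprB mulNr -subrX1 opprB lerBlDr lerDl.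
by apply: exprn_ge0; exact: ltW.
Qed.

(** Each sphere alone is bounded by the whole sum, so n (Lam(-a) - b) is bounded above. *)
Lemma manhattan_not_summable (a b : R) :
  (\esum_(x in [set: G]) (expR (- a * D x - b * (len x)%:R))%:E < +oo)%E ->
  Lam (- a) <= b.
Proof.
set s := esum _ _ => sfin.
have hs n : ((\sum_(x <- wsphere S n) expR (- a * D x - b * (len x)%:R))%:E <= s)%E.
  apply: ereal_sup_ubound; exists (sphere S n); first by split => //; exact: finite_sphere.
  by rewrite fsbig_finite ?sumEFin //; exact: finite_sphere.
have [M sM] : exists M : R, s = M%:E.
  case: s sfin hs => [M _ _|//|_ /(_ 0%N)]; first by exists M.
  by rewrite leeNy_eq.
suff : Lam (- a) - b <= 0 by lra.
apply: (@natmul_bounded_le0 _ _ (defect C codes (- a) + ln M)) => n.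
have := hs n; rewrite sM lee_fin sphere_sum_manhattan => h.
have /andP[h2 _] := partition_fun_bounds qa hLam n (- a).
have {}h := le_trans (ler_wpM2l (expR_ge0 (- (n%:R * b))) h2) h.
rewrite -expRD in h.
have M0 : 0 < M by apply: lt_le_trans h; exact: expR_gt0.
by rewrite -[M in _ <= M]lnK ?posrE // ler_expR in h; lra.
Qed.

Lemma manhattanE (a : R) : manhattan d S a = (Lam (- a))%:E.
Proof.
apply/le_anti/andP; split.
  apply/lee_addgt0Pr => e e0; rewrite -EFinD.
  apply: ereal_inf_lbound; exists (Lam (- a) + e) => //=.
  by apply: manhattan_summable; rewrite ltrDl.
apply: le_ereal_inf_tmp => _ [b /= hb <-]; rewrite lee_fin.
exact: manhattan_not_summable.
Qed.

Lemma rateE s : rate d S s =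
  ((Lam 0)%:E + ereal_sup (range (fun t => (t * s - Lam t)%:E)))%E.
Proof.
rewrite /rate manhattanE oppr0.
have -> // : (fun t : R => ((t * s)%:E - manhattan d S (- t))%E) =
    (fun t => (t * s - Lam t)%:E).
by apply/funext => t; rewrite manhattanE opprK EFinB.
Qed.

Lemma rate_ge s t : ((t * s - Lam t + Lam 0)%:E <= rate d S s)%E.
Proof.
rewrite rateE EFinD addeC leeD2lE //; apply: ereal_sup_ubound.
by exists t.
Qed.

Lemma rate_le s r : (forall t, t * s - Lam t + Lam 0 <= r) -> (rate d S s <= r%:E)%E.
Proof.
move=> h; have -> : r = Lam 0 + (r - Lam 0) by ring.
rewrite rateE EFinD leeD2lE //; apply: ge_ereal_sup => _ [t _ <-].
by rewrite lee_fin; have := h t; lra.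
Qed.

Lemma rate_ge0 s : (0 <= rate d S s)%E.
Proof. by have := rate_ge s 0; rewrite mul0r sub0r addNr. Qed.

Lemma card_sphereE n : card_set R (sphere S n) = ZT n 0.
Proof.
rewrite /partition_fun; under eq_bigr do rewrite mul0r expR0.
by rewrite big_const_seq count_predT iter_addr_0.
Qed.

Lemma card_sphere_partE (A : set R) n :
  card_set R [set x | sphere S n x /\ A (D x / n%:R)] =
  Z n 0 (fun r => `[< A (r / n%:R) >]).
Proof.
rewrite /partition_fun; under eq_bigr do rewrite mul0r expR0.
rewrite -big_filter big_const_seq count_predT iter_addr_0 /card_set; congr (_%:R).
apply: perm_size; apply: uniq_perm; first exact: fset_uniq.
  by apply: filter_uniq; exact: fset_uniq.
have fin : finite_set [set x | sphere S n x /\ A (D x / n%:R)].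
  by apply: sub_finite_set (finite_sphere hS n) => x [].
move=> x; rewrite mem_filter in_fset_set // (in_wsphere hS).
apply/idP/andP => [/set_mem[/= h1 h2]|[/asboolP h1 /eqP h2]].
  by split; [apply/asboolP|apply/eqP].
by apply/mem_set.
Qed.

Lemma log_proportion_ge (A : set R) n rho : (0 < n)%N ->
  expR (- (n%:R * rho)) * ZT n 0 <= Z n 0 (fun r => `[< A (r / n%:R) >]) ->
  ((- rho)%:E <= log_proportion d S A n)%E.
Proof.
move=> n0; have n0' : 0 < n%:R :> R by rewrite ltr0n.
have Z0 := partition_fun_gt0 qa n 0.
rewrite /log_proportion card_sphereE card_sphere_partE -ler_pdivlMr // [X in _ <= X]mulrC => h.
have h0 := lt_le_trans (expR_gt0 _) h.
rewrite lne_EFin // -EFinM lee_fin ler_pdivlMl // mulrN.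
by rewrite -[X in X <= _]expRK ler_ln ?posrE ?expR_gt0.
Qed.

Lemma log_proportion_le (A : set R) n rho : (0 < n)%N ->
  Z n 0 (fun r => `[< A (r / n%:R) >]) <= expR (- (n%:R * rho)) * ZT n 0 ->
  (log_proportion d S A n <= (- rho)%:E)%E.
Proof.
move=> n0; have n0' : 0 < n%:R :> R by rewrite ltr0n.
have Z0 := partition_fun_gt0 qa n 0.
rewrite /log_proportion card_sphereE card_sphere_partE -ler_pdivrMr // [X in X <= _]mulrC => h.
set p := _^-1 * _ in h *.
(* If no point of the sphere qualifies, the logarithm is -oo. *)
have [p0|p0] := leP p 0.
  by rewrite le0_lneNy ?lee_fin // gt0_muleNy ?leNye // lte_fin invr_gt0.
rewrite lne_EFin // -EFinM lee_fin ler_pdivrMl // mulrN.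
by rewrite -[leRHS]expRK ler_ln ?posrE ?expR_gt0.
Qed.

Lemma log_proportion_mono (A B : set R) n : A `<=` B ->
  (log_proportion d S A n <= log_proportion d S B n)%E.
Proof.
move=> AB; rewrite /log_proportion card_sphereE !card_sphere_partE.
apply: lee_wpmul2l; first by rewrite lee_fin invr_ge0.
have Z0 := ltW (partition_fun_gt0 qa n 0).
have p0 E : 0 <= (ZT n 0)^-1 * Z n 0 (fun r => `[< E (r / n%:R) >]).
  by rewrite mulr_ge0 ?invr_ge0 // partition_fun_ge0.
rewrite lee_lne ?in_itv /= ?lee_fin ?p0 ?leey //.
rewrite ler_wpM2l ?invr_ge0 //; apply: partition_fun_mono => r /asboolP h.
by apply/asboolP; exact: AB.
Qed.

(** * Convergence of the mean distortion *)

Lemma card_wballE n : (#|` wball S n|)%:R = \sum_(k < n.+1) ZT k 0.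
Proof.
have <- : \sum_(x <- wball S n) (1 : R) = (#|` wball S n|)%:R.
  by rewrite big_const_seq count_predT iter_addr_0.
rewrite sum_wball; apply: eq_bigr => k _; rewrite /partition_fun.
by apply: eq_bigr => x _; rewrite mul0r expR0.
Qed.

(** Inside a window of half-width k e / 2 the deviation is small; outside it is at most M k, on a
    proportion e / (2 M) of the sphere. *)
Lemma distortion_concentration (tau e : R) : gradient Lam 0 tau -> 0 < e ->
  exists k0 : nat, forall k, (k0 <= k)%N ->
    \sum_(x <- wsphere S k) `|D x - k%:R * tau| <= e * k%:R * ZT k 0.
Proof.
move=> htau e0; have [[L0 _] _ hL _ _] := qa.
pose M := L + `|tau| + 1.
have M0 : 0 < M by rewrite ltr_wpDl // addr_ge0.
have e2 : 0 < e / 2 by rewrite divr_gt0.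
have p0 : 0 < e / (2 * M) by rewrite divr_gt0 // mulr_gt0.
have [k0 hk0] := concentration qa hLam htau e2 p0.
exists k0 => k /hk0 hk.
set P := predC _ in hk.
apply: le_trans (_ : k%:R * (e / 2) * ZT k 0 + M * k%:R * Z k 0 P <= _).
  rewrite /partition_fun [X in _ <= _ + M * k%:R * X]big_mkcond !mulr_sumr -big_split /=.
  rewrite big_seq [leRHS]big_seq; apply: ler_sum => x xk.
  rewrite mul0r expR0 mulr1; case: ifPn => [_|]; last first.
    by rewrite /P /= negbK /window mulr0 addr0.
  rewrite mulr1; apply: le_trans (ler_normB _ _) _.
  rewrite normrM (ger0_norm (ler0n _ k)).
  have := hL k x xk; have k0' : 0 <= k%:R :> R by [].
  have : 0 <= k%:R * (e / 2) by rewrite mulr_ge0 // ltW.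
  by rewrite /M; lra.
have h : M * k%:R * Z k 0 P <= M * k%:R * (e / (2 * M) * ZT k 0).
  by apply: ler_wpM2l => //; rewrite mulr_ge0 // ltW.
have E : M * k%:R * (e / (2 * M) * ZT k 0) = k%:R * (e / 2) * ZT k 0.
  by field; rewrite gt_eqF.
by lra.
Qed.

(** The average divides by r and not by the length of each point, so only lengths close to r may
    count. With n the integer part of r, the ball of radius n - j is at most the fraction 1 / (1 + j
    eps) of the whole, and on the remaining spheres the length differs from r by at most j + 1. *)
Lemma average_distortion_cvg (tau eps : R) : gradient Lam 0 tau -> 0 < eps ->
  (forall n t, (1 + t%:R * eps) * #|` wball S n|%:R <= #|` wball S (n + t)|%:R) ->
  average_distortion d S r @[r --> +oo] --> tau.
Proof.
have arith (a b c k : nat) : (a + b + 1 <= c)%N -> (c - b < k)%N ->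
    (a <= k)%N /\ (c.+1 <= k + (b + 1))%N by clear; lia.
move=> htau eps0 hgrowth; have [[L0 _] _ hL _ _] := qa.
apply/cvgrPdist_le => e e0.
have e4 : 0 < e / 4 by rewrite divr_gt0.
have [k0 hk0] := distortion_concentration htau e4.
pose M := L + `|tau|; have M0 : 0 <= M by rewrite addr_ge0.
(* Chosen so that the inner ball, where only the bound M is available, contributes at most e / 4. *)
pose j := (Num.truncn (4 * M / (e * eps))).+1.
have jM : M <= e / 4 * (1 + j%:R * eps).
  have : 4 * M / (e * eps) < j%:R by exact: truncnS_gt.
  by rewrite ltr_pdivrMr ?mulr_gt0 //; lra.
near=> r.
have rk : (k0 + j + 1)%:R <= r by near: r; apply: nbhs_pinfty_ge; exact: num_real.
have rj : 4 * `|tau| * (j + 1)%:R / e <= r by near: r; apply: nbhs_pinfty_ge; exact: num_real.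
have r0 : 0 < r by apply: lt_le_trans rk; rewrite ltr0n addn1.
pose n := Num.truncn r.
have nr : n%:R <= r by rewrite -truncn_ge_nat ?ltW.
have rn : r < n.+1%:R by exact: truncnS_gt.
have kn : (k0 + j + 1 <= n)%N by rewrite truncn_ge_nat ?ltW.
have b0 : 0 < #|` wball S n|%:R :> R by rewrite ltr0n (card_wball_gt0 hS).
have ballE : word_ball S r = [set x | (len x <= n)%N].
  by apply/funext => x; rewrite /word_ball /= /n truncn_ge_nat // ltW.
have avgE : average_distortion d S r =
    #|` wball S n|%:R^-1 * \sum_(x <- wball S n) (D x / r).
  by rewrite /average_distortion ballE fsbig_finite //; exact: finite_word_ball.
have sphere_le k : (k < n.+1)%N -> \sum_(x <- wsphere S k) `|D x / r - tau| <=
    (if (k < (n - j).+1)%N then M * ZT k 0 else 0) + e / 2 * ZT k 0.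
  rewrite ltnS => kln; have Zk := partition_fun_gt0 qa k 0.
  have kr : k%:R <= r by apply: le_trans nr; rewrite ler_nat.
  case: ltnP => kj.
    apply: le_trans (_ : M * ZT k 0 <= _); last by rewrite lerDl mulr_ge0 ?divr_ge0 ?ltW.
    rewrite mulr_sumr big_seq [leRHS]big_seq; apply: ler_sum => x xk.
    rewrite mul0r expR0 mulr1; apply: le_trans (ler_normB _ _) _; rewrite /M lerD2r.
    rewrite normrM normfV (gtr0_norm r0) ler_pdivrMr //; apply: le_trans (hL k x xk) _.
    exact: ler_wpM2l.
  have [kk0 nkj] := arith _ _ _ _ kn kj.
  have h1 := hk0 k kk0.
  have rkj : r - k%:R <= (j + 1)%:R.
    have : n.+1%:R <= k%:R + (j + 1)%:R :> R by rewrite -natrD ler_nat.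
    by lra.
  rewrite add0r -(ler_pM2l r0) mulr_sumr.
  apply: le_trans (_ : \sum_(x <- wsphere S k) `|D x - k%:R * tau| +
      (j + 1)%:R * `|tau| * ZT k 0 <= _).
    rewrite mulr_sumr -big_split /=; apply: ler_sum => x _.
    rewrite mul0r expR0 mulr1 -{1}(gtr0_norm r0) -normrM.
    have -> : r * (D x / r - tau) = (D x - k%:R * tau) - (r - k%:R) * tau.
      by rewrite mulrBr mulrCA divff ?gt_eqF // mulr1; ring.
    apply: le_trans (ler_normB _ _) _; rewrite lerD2l normrM ler_wpM2r //.
    by rewrite ger0_norm ?subr_ge0.
  rewrite ler_pdivrMr // in rj.
  have h2 : (j + 1)%:R * `|tau| * ZT k 0 <= e / 4 * r * ZT k 0.
    by rewrite ler_pM2r //; lra.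
  have h3 : e / 4 * k%:R * ZT k 0 <= e / 4 * r * ZT k 0.
    by rewrite ler_pM2r // ler_pM2l.
  by lra.
have -> : tau - average_distortion d S r =
    - (#|` wball S n|%:R^-1 * \sum_(x <- wball S n) (D x / r - tau)).
  rewrite avgE sumrB mulrBr opprB; congr (_ - _).
  by rewrite big_const_seq count_predT iter_addr_0 -[tau *+ _]mulr_natl mulKf // gt_eqF.
rewrite normrN normrM normfV (gtr0_norm b0) mulrC ler_pdivrMr //.
apply: le_trans (ler_norm_sum _ _ _) _; rewrite sum_wball.
apply: le_trans (ler_sum _ (fun (k : 'I_n.+1) _ => sphere_le k (ltn_ord k))) _.
rewrite big_split /= -big_mkcond /=.
rewrite -(big_ord_widen n.+1 (fun k => M * ZT k 0)) ?ltnS ?leq_subr //.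
rewrite -!mulr_sumr -!card_wballE.
have jn : (j <= n)%N by apply: leq_trans kn; rewrite addn1 ltnW // ltnS leq_addl.
have := hgrowth (n - j)%N j; rewrite subnK //.
set b := #|` wball S n|%:R; set b' := #|` wball S (n - j)|%:R => hb.
have b'0 : 0 <= b' by exact: ler0n.
have : M * b' <= e / 4 * (1 + j%:R * eps) * b' by exact: ler_wpM2r.
have : e / 4 * ((1 + j%:R * eps) * b') <= e / 4 * b by rewrite ler_pM2l.
have : 0 <= e * b by rewrite mulr_ge0 // ltW.
rewrite /b; lra.
Unshelve. all: by end_near.
Qed.

End WithPressure.
End Assembly.

(** * Upper and lower limits of extended real sequences *)

Lemma limn_esup_le_near (R : realType) (u : (\bar R)^nat) (c : \bar R) n0 :
  (forall n, (n0 <= n)%N -> (u n <= c)%E) -> (limn_esup u <= c)%E.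
Proof.
move=> h; apply: ge_ereal_inf; exists (ereal_sup [set u n | n in [set n | (n0 <= n)%N]]).
  by exists [set n | (n0 <= n)%N] => //; exists n0.
by apply: ge_ereal_sup => _ [n /= n0n <-]; exact: h.
Qed.

Lemma limn_einf_ge_near (R : realType) (u : (\bar R)^nat) (c : \bar R) n0 :
  (forall n, (n0 <= n)%N -> (c <= u n)%E) -> (c <= limn_einf u)%E.
Proof.
move=> h; rewrite /limn_einf leeNr; apply: (@limn_esup_le_near _ _ _ n0) => n n0n.
by rewrite leeN2; exact: h.
Qed.

Lemma le_limn_esup (R : realType) (u v : (\bar R)^nat) :
  (forall n, (u n <= v n)%E) -> (limn_esup u <= limn_esup v)%E.
Proof.
move=> uv; apply: le_ereal_inf_tmp => _ [V ooV <-].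
apply: ge_ereal_inf; exists (ereal_sup [set u n | n in V]); first by exists V.
apply: ge_ereal_sup => _ [n Vn <-]; apply: le_trans (uv n) _.
by apply: ereal_sup_ubound; exists n.
Qed.

Unset Implicit Arguments.

Theorem theorem4p23 (R : realType) (G : groupType) (S : set G)
    (d : G -> G -> R)
    (hG : non_elementary_hyperbolic R G)
    (hS : finite_symmetric_generators S)
    (hd : D_metric d) :
  (forall U V : set R, open U -> closed V -> U `<=` V ->
    [/\ (- ereal_inf [set rate d S s | s in U]
           <= limn_einf (log_proportion d S U))%E,
        (limn_einf (log_proportion d S U)
           <= limn_esup (log_proportion d S V))%E &
        (limn_esup (log_proportion d S V)
           <= - ereal_inf [set rate d S s | s in V])%E]) /\
  (exists tau alpha_min alpha_max : R,
    [/\ average_distortion d S r @[r --> +oo] --> tau,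
        (manhattan d S a * (a^-1)%:E)%E @[a --> +oo] --> (- alpha_min)%:E &
        (manhattan d S a * (a^-1)%:E)%E @[a --> -oo] --> (- alpha_max)%:E] /\
    [/\ forall s : R, rate d S s = 0%E <-> s = tau,
        forall s : R, alpha_min < s -> s < alpha_max ->
          rate d S s \is a fin_num &
        forall s : R, s < alpha_min \/ alpha_max < s ->
          rate d S s = +oo%E]).
Proof.
have [[L [C [codes qa]]] [eps eps0 hgrowth]] := sphere_quasi_additive hS hd hG.2.
have [Lam hLam] := pressure_exists qa.
split.
  move=> U V oU cV UV; split.
  - rewrite leeNl; apply: le_ereal_inf_tmp => _ [s Us <-]; rewrite leeNl.
    have := rate_ge0 hS qa hLam s; case rs : (rate d S s) => [r| |] // _; last by rewrite leNye.
    have hr t : t * s - Lam t + Lam 0 <= r.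
      by rewrite -lee_fin -rs; exact: (rate_ge hS qa hLam).
    apply/lee_subgt0Pr => e e0; rewrite -EFinN -EFinB -opprD.
    have rho : r < r + e by rewrite ltrDl.
    have [n0 hn0] := ldp_lower qa hLam oU Us hr rho.
    apply: (@limn_einf_ge_near _ _ _ n0.+1) => n n0n.
    apply: (log_proportion_ge hS qa); first by apply: leq_trans n0n.
    by apply: hn0; exact: ltnW.
  - apply: le_trans (limn_einf_sup _) _.
    by apply: le_limn_esup => n; exact: (log_proportion_mono hS qa).
  - set m := ereal_inf _.
    have key (rho : R) : 0 <= rho -> (rho%:E < m)%E ->
        (limn_esup (log_proportion d S V) <= (- rho)%:E)%E.
      move=> rho0 rhom.
      have [v Vv|n0 hn0] := ldp_upper qa hLam cV rho0.
        apply: contrapT => hno; have : (m <= rho%:E)%E; last by rewrite leNgt rhom.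
        apply: le_trans (_ : (rate d S v <= _)%E); first by apply: ereal_inf_lbound; exists v.
        apply: (rate_le hS qa hLam) => t; rewrite leNgt; apply/negP => h.
        by apply: hno; exists t.
      apply: (@limn_esup_le_near _ _ _ n0.+1) => n n0n.
      apply: (log_proportion_le hS qa); first by apply: leq_trans n0n.
      by apply: hn0; exact: ltnW.
    (* Covers a finite infimum smaller than the error e, where [key] would be needed at a negative
       rho. *)
    have esup0 : (limn_esup (log_proportion d S V) <= 0)%E.
      suff : (limn_esup (log_proportion d S V) <= (- 0)%:E)%E by rewrite oppr0.
      apply: (@limn_esup_le_near _ _ _ 1) => n n0.
      apply: (log_proportion_le hS qa) => //.
      by rewrite mulr0 oppr0 expR0 mul1r; exact: partition_fun_mono.
    have m0 : (0 <= m)%E.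
      by apply: le_ereal_inf_tmp => _ [s _ <-]; exact: (rate_ge0 hS qa hLam).
    case: m m0 key => [m| |] // m0 key.
      apply/lee_addgt0Pr => e e0; rewrite -EFinN -EFinD.
      have [em|me] := leP e m.
        have -> : - m + e = - (m - e) by rewrite opprB addrC.
        apply: key; first by rewrite subr_ge0.
        by rewrite lte_fin ltrBlDr ltrDl.
      apply: le_trans esup0 _; rewrite lee_fin; lra.
    case: (limn_esup _) esup0 key => [l| |] // _ key.
    (* The infimum is +oo, for instance when [V] is empty: a rho of at least 1 - l would bound the
       limit l by l - 1. *)
    have := key (Num.max 0 (1 - l)); rewrite le_max lexx ltry => /(_ isT isT).
    have : 1 - l <= Num.max 0 (1 - l) by rewrite le_max lexx orbT.
    by rewrite lee_fin => h1 h2; exfalso; move: h1 h2; lra.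
have [tau htau] := gradient_exists qa hLam 0.
have [amax [max_le max_ge max_cvg]] := asymptotic_slope qa hLam.
(* For the reflected data the slope at +oo is minus the slope of [Lam] at -oo; hence the witness
   [- amin]. *)
have [amin [min_le min_ge min_cvg]] :=
  asymptotic_slope (quasi_additive_opp qa) (pressure_opp hLam).
have mE := manhattanE hS qa hLam.
exists tau, (- amin), amax; split; split.
- exact: (average_distortion_cvg hS qa hLam htau eps0 hgrowth).
- have -> : (fun a => (manhattan d S a * (a^-1)%:E)%E) = (fun a => (Lam (- a) / a)%:E).
    by apply/funext => a; rewrite mE -EFinM.
  by rewrite opprK; apply: cvg_EFin => //; exact: nearW.
- have -> : (fun a => (manhattan d S a * (a^-1)%:E)%E) = (fun a => (Lam (- a) / a)%:E).
    by apply/funext => a; rewrite mE -EFinM.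
  apply: cvg_EFin; first exact: nearW.
  apply/cvgNy_compNP; rewrite /comp /=.
  have -> : (fun a => Lam (- - a) / - a) = (fun a => - (Lam a / a)).
    by apply/funext => a; rewrite opprK invrN mulrN.
  exact: cvgN.
- move=> s; split => [rs|->].
    (* A zero of the rate makes s a subgradient of [Lam] at 0, and tangency there leaves only
       tau. *)
    apply/eqP; rewrite -subr_eq0; apply/eqP/linear_le_small => eta eta0.
    have [_ /(_ eta eta0)[u0 u00 hu]] := htau; exists u0 => // u uu0.
    have := rate_ge hS qa hLam s u; rewrite rs lee_fin.
    by have := hu u uu0; rewrite add0r; lra.
  apply/le_anti; rewrite (rate_ge0 hS qa hLam) andbT; apply: (rate_le hS qa hLam) => t.
  by have [/(_ t)] := htau; rewrite add0r; lra.
- move=> s smin smax.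
  have [t1 t10 h1] := max_ge s smax.
  have [|t2 t20 h2] := min_ge (- s); first by lra.
  rewrite oppr0 in h2.
  (* For t outside (-t2, t1) the eventual slope bounds make the left side nonpositive; inside, the
     Lipschitz bound applies. *)
  have hr t : t * s - Lam t + Lam 0 <= (`|s| + L) * (t1 + t2).
    have [[L0 _] _ _ _ _] := qa.
    have s0 := normr_ge0 s.
    have M0 : 0 <= (`|s| + L) * (t1 + t2) by rewrite mulr_ge0 ?addr_ge0 // ltW.
    have [ht|tt1] := leP t1 t; first by have := h1 t ht; lra.
    have [ht|tt2] := leP t2 (- t); first by have := h2 (- t) ht; rewrite opprK; lra.
    have tn : `|t| <= t1 + t2 by rewrite ler_norml; lra.
    have := pressure_lipschitz qa hLam t 0; rewrite sub0r normrN.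
    have : t * s <= `|t| * `|s| by rewrite -normrM ler_norm.
    have : (`|s| + L) * `|t| <= (`|s| + L) * (t1 + t2) by rewrite ler_wpM2l // addr_ge0.
    by lra.
  rewrite fin_numE; apply/andP; split.
    by apply/eqP => e; have := rate_ge0 hS qa hLam s; rewrite e.
  by apply/eqP => e; have := rate_le hS qa hLam hr; rewrite e.
- have infinite s : (forall A, exists t, A <= t * s - Lam t + Lam 0) -> rate d S s = +oo%E.
    move=> h; apply/eqyP => A _; have [t ht] := h A.
    by apply: le_trans (rate_ge hS qa hLam s t); rewrite lee_fin.
  move=> s [smin|smax]; apply: infinite => A.
    have x0 : 0 < - amin - s by rewrite subr_gt0.
    have t0 : 0 <= `|A| / (- amin - s) by rewrite divr_ge0 // ltW.
    (* Beyond the extreme slope the exponent grows at least linearly in |t|, at a rate given by the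
       gap, so this tilt reaches |A|. *)
    exists (- (`|A| / (- amin - s))).
    have := min_le _ t0; rewrite oppr0.
    have : `|A| / (- amin - s) * (- amin - s) = `|A| by rewrite divfK // gt_eqF.
    have := ler_norm A; lra.
  have x0 : 0 < s - amax by rewrite subr_gt0.
  have t0 : 0 <= `|A| / (s - amax) by rewrite divr_ge0 // ltW.
  exists (`|A| / (s - amax)).
  have := max_le _ t0.
  have : `|A| / (s - amax) * (s - amax) = `|A| by rewrite divfK // gt_eqF.
  have := ler_norm A; lra.
Qed.
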